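(* Let $(\mathbf x,B)$ be a seed of $\mathcal F$, and let $\mathbf y=(y_1,\dots,y_m)$ and $\mathbf z=(z_1,\dots,z_m)$ be disjoint clusters of $\mathcal A(\mathbf x,B)$. Suppose $U$ is a $K$-subalgebra of $\mathcal A(\mathbf x,B)$ which is a factorial ring and contains $$\{y_1,\dots,y_n,z_1,\dots,z_n,x_{n+1}^{\pm1},\dots,x_p^{\pm1},x_{p+1},\dots,x_m\}.$$ Then $U=\mathcal A(\mathbf x,B)=U(\mathbf y,\mathbf z)$. In particular $\mathcal A(\mathbf x,B)$ is factorial and all cluster variables of $\mathcal A(\mathbf x,B)$ are prime elements.
   Context: Let $K$ be a field of characteristic $0$ or $K=\mathbb Z$. Fix integers $m\ge p\ge n\ge 1$ with $m>1$, and let $\mathcal F=K(X_1,\dots,X_m)$. For $B=(b_{ij})\in M_{m,n}(\mathbb Z)$ the principal part $B^\circ$ is the $n\times n$ matrix formed by the first $n$ rows. $B$ is connected if the graph with vertices $1,\dots,m$ and an edge between $i$ and $j$ whenever $b_{ij}\neq 0$ or $b_{ji}\ne 0$ is connected. A square integer matrix $A$ is skew-symmetrizable if $DA$ is skew-symmetric for some diagonal integer matrix $D$ with positive diagonal entries. A seed of $\mathcal F$ is a pair $(\mathbf x,B)$ where $B\in M_{m,n}(\mathbb Z)$ is connected with $B^\circ$ skew-symmetrizable, and $\mathbf x=(x_1,\dots,x_m)$ is an $m$-tuple of elements of $\mathcal F$ algebraically independent over $K$. For $1\le k\le n$ the mutation $\mu_k(\mathbf x,B)=(\mathbf x',B')$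 is given by $b'_{ij}=-b_{ij}$ if $i=k$ or $j=k$, and $b'_{ij}=b_{ij}+\frac{|b_{ik}|b_{kj}+b_{ik}|b_{kj}|}{2}$ otherwise; $x'_s=x_s$ for $s\neq k$ and $x'_k=x_k^{-1}\big(\prod_{b_{ik}>0}x_i^{b_{ik}}+\prod_{b_{ik}<0}x_i^{-b_{ik}}\big)$. Two seeds are mutation equivalent if one is obtained from the other by a finite sequence of mutations $\mu_{i_1},\dots,\mu_{i_t}$ with $1\le i_j\le n$. The cluster algebra $\mathcal A(\mathbf x,B)$ is the $K$-subalgebra of $\mathcal F$ generated by $x_{n+1}^{\pm1},\dots,x_p^{\pm1},x_{p+1},\dots,x_m$ together with all elements $y_1,\dots,y_n$ for all seeds $(\mathbf y,C)$ mutation equivalent to $(\mathbf x,B)$; these $y_i$ ($1\le i\le n$) are the cluster variables, and for such a seed $\mathbf y$ is called a cluster (note $y_i=x_i$ for $n<i\le m$). Two clusters $\mathbf y,\mathbf z$ are disjoint if $\{y_1,\dots,y_n\}\cap\{z_1,\dots,z_n\}=\varnothing$. For a cluster $\mathbf y$ let $\mathscr L_{\mathbf y}=K[y_1^{\pm1},\dots,y_p^{\pm1},y_{p+1},\dots,y_m]\subseteq\mathcal F$, and set $U(\mathbf y,\mathbf z)=\mathscr L_{\mathbf y}\cap\mathscr L_{\mathbf z}$. *)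

(* Defs.v *)
From HB Require Import structures.
From mathcomp Require Import all_boot all_order all_algebra all_fingroup.
From mathcomp Require Import fraction.
From mathcomp Require Import mpoly.

Set Implicit Arguments.
Unset Strict Implicit.
Unset Printing Implicit Defensive.

Import Order.TTheory GRing.Theory Num.Theory.
Local Open Scope ring_scope.

Definition F (K : idomainType) (m : nat) : fieldType := {fraction {mpoly K[m]}}.

Section ClusterDefs.
Context (K : idomainType) (m n : nat).

Local Notation FF := (F K m).

Definition Kemb (c : K) : FF := tofrac (c%:MP : {mpoly K[m]}).

(* entries of B indexed by (0-based) natural numbers; 0 outside the range *)
Definition Bnat (B : 'M[int]_(m, n)) (i j : nat) : int :=
  match @insub nat (fun k => k < m)%N 'I_m i, @insub nat (fun k => k < n)%N 'I_n j with
  | Some i', Some j' => B i' j'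
  | _, _ => 0
  end.

Definition principal (B : 'M[int]_(m, n)) : 'M[int]_n :=
  \matrix_(i < n, j < n) Bnat B i j.

Definition skew_symmetrizable (A : 'M[int]_n) : Prop :=
  exists d : 'I_n -> int, (forall i, 0 < d i) /\
    (forall i j, d i * A i j = - (d j * A j i)).

Definition connectedB (B : 'M[int]_(m, n)) : Prop :=
  forall i j : 'I_m,
    connect (fun a b : 'I_m => (Bnat B a b != 0) || (Bnat B b a != 0)) i j.

Definition alg_indep (x : 'I_m -> FF) : Prop :=
  forall q : {mpoly K[m]}, mmap Kemb x q = 0 -> q = 0.

Definition is_seed (x : 'I_m -> FF) (B : 'M[int]_(m, n)) : Prop :=
  connectedB B /\ skew_symmetrizable (principal B) /\ alg_indep x.

Definition mutB (k : 'I_n) (B : 'M[int]_(m, n)) : 'M[int]_(m, n) :=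
  \matrix_(i < m, j < n)
    if (val i == val k) || (val j == val k) then - B i j
    else B i j + ((`|Bnat B i k| * Bnat B k j + Bnat B i k * `|Bnat B k j|) %/ 2)%Z.

Definition mutx (k : 'I_n) (x : 'I_m -> FF) (B : 'M[int]_(m, n)) : 'I_m -> FF :=
  fun s => if val s == val k then
             (x s)^-1 * (\prod_(i < m | 0 < B i k) x i ^+ `|B i k|%N
                         + \prod_(i < m | B i k < 0) x i ^+ `|B i k|%N)
           else x s.

Definition mutate (k : 'I_n) (S : ('I_m -> FF) * 'M[int]_(m, n)) :=
  (mutx k S.1 S.2, mutB k S.2).

Definition mut_equiv (S T : ('I_m -> FF) * 'M[int]_(m, n)) : Prop :=
  exists ks : seq 'I_n, foldl (fun S k => mutate k S) S ks = T.

Inductive gen (S : FF -> Prop) : FF -> Prop :=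
  | gen_base f : S f -> gen S f
  | gen_K c : gen S (Kemb c)
  | gen_add a b : gen S a -> gen S b -> gen S (a + b)
  | gen_opp a : gen S a -> gen S (- a)
  | gen_mul a b : gen S a -> gen S b -> gen S (a * b).

Definition Ksubalg (S : FF -> Prop) : Prop :=
  (forall c, S (Kemb c)) /\ (forall a b, S a -> S b -> S (a + b)) /\
  (forall a, S a -> S (- a)) /\ (forall a b, S a -> S b -> S (a * b)).

Definition is_cluster (x : 'I_m -> FF) (B : 'M[int]_(m, n)) (y : 'I_m -> FF) : Prop :=
  exists C : 'M[int]_(m, n), mut_equiv (x, B) (y, C).

Definition is_cluster_var (x : 'I_m -> FF) (B : 'M[int]_(m, n)) (f : FF) : Prop :=
  exists (y : 'I_m -> FF), is_cluster x B y /\ exists i : 'I_m, (i < n)%N /\ f = y i.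

Definition disjoint_clusters (y z : 'I_m -> FF) : Prop :=
  forall i j : 'I_m, (i < n)%N -> (j < n)%N -> y i <> z j.

(* the cluster algebra A(x,B) (0-based indices: x_{n+1..p} are i with n <= i < p) *)
Definition clalg (p : nat) (x : 'I_m -> FF) (B : 'M[int]_(m, n)) : FF -> Prop :=
  gen (fun f => (exists i : 'I_m, (n <= i < p)%N /\ (f = x i \/ f = (x i)^-1))
             \/ (exists i : 'I_m, (p <= i)%N /\ f = x i)
             \/ is_cluster_var x B f).

Definition laurent (p : nat) (y : 'I_m -> FF) : FF -> Prop :=
  gen (fun f => exists i : 'I_m,
        ((i < p)%N /\ (f = y i \/ f = (y i)^-1)) \/ ((p <= i)%N /\ f = y i)).

Definition Uyz (p : nat) (y z : 'I_m -> FF) : FF -> Prop :=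
  fun f => laurent p y f /\ laurent p z f.

Definition is_subring (S : FF -> Prop) : Prop :=
  S 0 /\ S 1 /\ (forall a b, S a -> S b -> S (a + b)) /\
  (forall a, S a -> S (- a)) /\ (forall a b, S a -> S b -> S (a * b)).

Definition unitIn (S : FF -> Prop) (a : FF) : Prop :=
  S a /\ exists b, S b /\ a * b = 1.

Definition dvdIn (S : FF -> Prop) (a b : FF) : Prop :=
  exists c, S c /\ b = a * c.

Definition assocIn (S : FF -> Prop) (a b : FF) : Prop :=
  exists u, unitIn S u /\ a = u * b.

Definition irredIn (S : FF -> Prop) (a : FF) : Prop :=
  S a /\ a <> 0 /\ ~ unitIn S a /\
  (forall b c, S b -> S c -> a = b * c -> unitIn S b \/ unitIn S c).

Definition primeIn (S : FF -> Prop) (a : FF) : Prop :=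
  S a /\ a <> 0 /\ ~ unitIn S a /\
  (forall b c, S b -> S c -> dvdIn S a (b * c) -> dvdIn S a b \/ dvdIn S a c).

Definition is_factorial (S : FF -> Prop) : Prop :=
  is_subring S /\
  (forall a, S a -> a <> 0 -> ~ unitIn S a ->
     exists s : seq FF, (forall q, q \in s -> irredIn S q) /\ a = \prod_(q <- s) q) /\
  (forall s t : seq FF, (forall q, q \in s -> irredIn S q) ->
     (forall q, q \in t -> irredIn S q) -> \prod_(q <- s) q = \prod_(q <- t) q ->
     exists t' : seq FF, perm_eq t t' /\ size s = size t' /\
       forall i, (i < size s)%N -> assocIn S (nth 0 s i) (nth 0 t' i)).

End ClusterDefs.

(* Main.v *)
Require Import Defs.
From HB Require Import structures.
From mathcomp Require Import all_boot all_order all_algebra all_fingroup.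
From mathcomp Require Import fraction.
From mathcomp Require Import mpoly zify ring.
From Stdlib Require Import FunctionalExtensionality PropExtensionality Classical_Prop.
Set Implicit Arguments.
Unset Strict Implicit.
Unset Printing Implicit Defensive.
Import Order.TTheory GRing.Theory Num.Theory.
Local Open Scope ring_scope.

(* The proof rests on the Laurent phenomenon. For a mutation path starting at i and j, one
   adjoins a single frozen variable t which enters the exchange relation at j but not the one
   at i. Over the Laurent ring L of the initial cluster, the variable obtained by mutating at i
   is then free of t, while those obtained by mutating next at j and again at i are polynomials
   in t whose constant terms are units of L. By induction on the length of the path, a power of
   the first new variable, and also a power of the product of the other two, clears the
   denominators of a final variable up to powers of t. These denominators being coprime, no
   denominator but t is needed, and t = 1 gives the claim. As exchange relations take positive
   values at points with one vanishing frozen coordinate and the others equal to 1,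
   noninvertible frozen variables never occur in denominators.

   Comparing the Laurent expansions in a cluster and in its neighbours shows that the units of
   the cluster algebra A are unit scalars times Laurent monomials in x_{n+1},...,x_p, that
   cluster variables are irreducible, and, by integrality and positivity, that associated
   cluster variables are equal. In the factorial ring U the variables y_i are therefore primes
   not dividing any z_j, so that an element with a denominator that is a monomial in the y_i and
   another one that is a monomial in the z_j lies in U. Hence U(y,z) is contained in U, which is
   contained in A, which is contained in U(y,z). *)

(** * Subrings and localisations *)

Section SubringPredicates.
Variable R : nzRingType.
Implicit Types (L S : R -> Prop).

Record subring L : Prop := Subring {
  subring1 : L 1;
  subringD : forall a b, L a -> L b -> L (a + b);
  subringN : forall a, L a -> L (- a);
  subringM : forall a b, L a -> L b -> L (a * b) }.

Section Closure.
Variable L : R -> Prop.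
Hypothesis L_subring : subring L.

Lemma subring0 : L 0.
Proof.
have L1 := subring1 L_subring.
by rewrite -(subrr 1); apply: subringD => //; apply: subringN.
Qed.

Lemma subringX a k : L a -> L (a ^+ k).
Proof.
move=> La; elim: k => [|k IH]; first by rewrite expr0; exact: subring1.
by rewrite exprS; exact: subringM.
Qed.

Lemma subring_sum (I : Type) (r : seq I) (P : pred I) (f : I -> R) :
  (forall i, P i -> L (f i)) -> L (\sum_(i <- r | P i) f i).
Proof. by move=> Lf; apply: (big_ind L) => //; [exact: subring0 | exact: subringD]. Qed.

Lemma subring_prod (I : Type) (r : seq I) (P : pred I) (f : I -> R) :
  (forall i, P i -> L (f i)) -> L (\prod_(i <- r | P i) f i).
Proof. by move=> Lf; apply: (big_ind L) => //; [exact: subring1 | exact: subringM]. Qed.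

Lemma subring_int (z : int) : L z%:~R.
Proof.
have Lnat (k : nat) : L k%:R.
  by rewrite -{1}(card_ord k) -sumr_const; apply: subring_sum => i _; exact: subring1.
by case: z => k; rewrite ?NegzE ?mulrNz; [|apply: subringN => //]; exact: Lnat.
Qed.

End Closure.

Inductive generated_ring S : R -> Prop :=
  | generated_base f : S f -> generated_ring S f
  | generated1 : generated_ring S 1
  | generatedD a b : generated_ring S a -> generated_ring S b -> generated_ring S (a + b)
  | generatedN a : generated_ring S a -> generated_ring S (- a)
  | generatedM a b : generated_ring S a -> generated_ring S b -> generated_ring S (a * b).

Lemma subring_generated S : subring (generated_ring S).
Proof.
split; [exact: generated1 | exact: generatedD | exact: generatedN | exact: generatedM].
Qed.

Lemma generated_ring_min S L f :
  subring L -> (forall s, S s -> L s) -> generated_ring S f -> L f.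
Proof.
move=> L_subring SL; elim=> {f} [f /SL //||a b _ La _ Lb|a _ La|a b _ La _ Lb].
- exact: subring1.
- exact: subringD.
- exact: subringN.
- exact: subringM.
Qed.

End SubringPredicates.

Definition image_in (R R' : nzRingType) (phi : {rmorphism R -> R'}) (L : R -> Prop)
  (f : R') : Prop := exists2 a, L a & f = phi a.

Lemma subring_image (R R' : nzRingType) (phi : {rmorphism R -> R'}) (L : R -> Prop) :
  subring L -> subring (image_in phi L).
Proof.
move=> L_subring; split=> [|_ _ [a La ->] [b Lb ->]|_ [a La ->]|_ _ [a La ->] [b Lb ->]].
- by exists 1; rewrite ?rmorph1 //; exact: subring1.
- by exists (a + b); rewrite ?rmorphD //; exact: subringD.
- by exists (- a); rewrite ?rmorphN //; exact: subringN.
- by exists (a * b); rewrite ?rmorphM //; exact: subringM.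
Qed.

Definition localisation (R : nzRingType) (L : R -> Prop) (w f : R) : Prop :=
  exists N : nat, L (f * w ^+ N).

Lemma subring_localisation (R : comNzRingType) (L : R -> Prop) w :
  subring L -> L w -> subring (localisation L w).
Proof.
move=> L_subring Lw; have LX N := subringX L_subring N Lw.
split=> [|a b [M La] [N Lb]|a [N La]|a b [M La] [N Lb]].
- by exists 0%N; rewrite mulr1; exact: subring1.
- exists (M + N)%N; rewrite exprD mulrDl; apply: subringD => //.
    by rewrite mulrA; apply: subringM.
  by rewrite mulrCA mulrC; apply: subringM.
- by exists N; rewrite mulNr; apply: subringN.
- by exists (M + N)%N; rewrite exprD mulrACA; apply: subringM.
Qed.

Lemma localisation_base (R : nzRingType) (L : R -> Prop) w f : L f -> localisation L w f.
Proof. by exists 0%N; rewrite mulr1. Qed.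

Section UnitsOfSubrings.
Variables (E : fieldType) (L : E -> Prop).
Hypothesis L_subring : subring L.

(* [a != 0] is not redundant: [0^-1 = 0]. *)
Definition unit_in (a : E) : Prop := [/\ a != 0, L a & L a^-1].

Lemma unit_in_mem a : unit_in a -> L a. Proof. by case. Qed.

Lemma unit_in1 : unit_in 1.
Proof. by split; rewrite ?oner_neq0 ?invr1 //; exact: subring1. Qed.

Lemma unit_inV a : unit_in a -> unit_in a^-1.
Proof. by case=> na La LaV; split; rewrite ?invr_eq0 ?invrK. Qed.

Lemma unit_inM a b : unit_in a -> unit_in b -> unit_in (a * b).
Proof.
by case=> na La LaV [nb Lb LbV]; split; rewrite ?mulf_neq0 ?invfM //; apply: subringM.
Qed.

Lemma unit_in_exprz a (z : int) : unit_in a -> unit_in (a ^ z).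
Proof.
case=> na La LaV; split; rewrite ?expfz_neq0 // ?invr_expz;
  by case: z => k; rewrite ?NegzE ?opprK -?exprz_inv; apply: subringX.
Qed.

(* [u] is congruent to [a] modulo [d L]; [d], [u] and [a] need not lie in [L]. *)
Definition eqmod_in (d u a : E) : Prop := exists2 c, L c & u = a + d * c.

Lemma eqmod_inDl b d u a : eqmod_in d u a -> eqmod_in d (b + u) (b + a).
Proof. by case=> c Lc ->; exists c; rewrite // addrA. Qed.

Lemma eqmod_in_divisor d d' u a : L d' -> eqmod_in (d * d') u a -> eqmod_in d u a.
Proof. by move=> Ld' [c Lc ->]; exists (d' * c); rewrite ?mulrA //; exact: subringM. Qed.

Lemma eqmod_inMl d u a b : L b -> eqmod_in d u a -> eqmod_in d (b * u) (b * a).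
Proof.
move=> Lb [c Lc ->]; exists (b * c); first exact: subringM.
by rewrite mulrDr mulrCA.
Qed.

Lemma eqmod_in_scale e d u a : eqmod_in d u a -> eqmod_in (e * d) (e * u) (e * a).
Proof. by case=> c Lc ->; exists c; rewrite // mulrDr mulrA. Qed.

Lemma eqmod_inX d u a k : L d -> L a -> eqmod_in d u a -> eqmod_in d (u ^+ k) (a ^+ k).
Proof.
move=> Ld La [c Lc ->]; elim: k => [|k [c' Lc' IH]].
  by exists 0; rewrite ?mulr0 ?addr0 //; exact: subring0.
exists (a ^+ k * c + (a + d * c) * c').
  apply: subringD => //; apply: subringM => //; first exact: subringX.
  by apply: subringD => //; apply: subringM.
rewrite exprS IH [a ^+ k.+1]exprS; ring.
Qed.

End UnitsOfSubrings.

(** * Seeds and mutations *)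

Section LaurentMonomials.
Variables (E : fieldType) (T : finType).
Implicit Types (x : T -> E) (e f : T -> int) (k : T).

Definition lmonom x e : E := \prod_i x i ^ e i.

Lemma eq_lmonom x e f : e =1 f -> lmonom x e = lmonom x f.
Proof. by move=> ef; apply: eq_bigr => i _; rewrite ef. Qed.

Lemma lmonom_neq0 x e : (forall i, x i != 0) -> lmonom x e != 0.
Proof. by move=> nx; apply/prodf_neq0 => i _; rewrite expfz_neq0. Qed.

Lemma lmonom0 x : lmonom x (fun=> 0) = 1.
Proof. by apply: big1 => i _; rewrite expr0z. Qed.

Lemma lmonomD x e f : (forall i, x i != 0) ->
  lmonom x (fun i => e i + f i) = lmonom x e * lmonom x f.
Proof. by move=> nx; rewrite -big_split; apply: eq_bigr => i _; rewrite expfzDr. Qed.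

Lemma lmonomN x e : lmonom x (fun i => - e i) = (lmonom x e)^-1.
Proof. by rewrite /lmonom -prodfV; apply: eq_bigr => i _; rewrite invr_expz. Qed.

Lemma lmonomX x e (k : nat) : lmonom x (fun i => e i * k%:Z) = lmonom x e ^+ k.
Proof. by rewrite /lmonom -prodrXl; apply: eq_bigr => i _; rewrite -exprz_exp. Qed.

Definition erase k e : T -> int := fun i => if i == k then 0 else e i.

Lemma erase_other k e i : i != k -> erase k e i = e i.
Proof. by rewrite /erase => /negbTE ->. Qed.

Lemma lmonom_erase k x e : lmonom x e = x k ^ e k * lmonom x (erase k e).
Proof.
rewrite /lmonom (bigD1 k) //= [in RHS](bigD1 k) //= /erase eqxx expr0z mul1r.
by congr (_ * _); apply: eq_bigr => i /negbTE ->.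
Qed.

Lemma eq_lmonom_erase k x x' e :
  (forall i, i != k -> x i = x' i) -> lmonom x (erase k e) = lmonom x' (erase k e).
Proof.
move=> xx'; apply: eq_bigr => i _; rewrite /erase.
by have [_|/xx' -> //] := eqVneq i k; rewrite !expr0z.
Qed.

Definition delta k : T -> int := fun i => (i == k)%:Z.

Lemma lmonom_delta k x : lmonom x (delta k) = x k.
Proof.
rewrite (lmonom_erase k) /delta eqxx expr1z (@eq_lmonom _ _ (fun=> 0)) ?lmonom0 ?mulr1 //.
by move=> i; rewrite /erase; case: eqP.
Qed.

Section InSubring.
Variable L : E -> Prop.
Hypothesis L_subring : subring L.

Lemma unit_in_lmonom x e :
  (forall i, e i = 0 \/ unit_in L (x i)) -> unit_in L (lmonom x e).
Proof.
move=> ux; apply: big_ind => [|a b|i _]; [exact: unit_in1 | exact: unit_inM |].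
by case: (ux i) => [->|/unit_in_exprz]; [rewrite expr0z; exact: unit_in1 | exact].
Qed.

Lemma subring_lmonom x e :
  (forall i, 0 <= e i) -> (forall i, e i = 0 \/ L (x i)) -> L (lmonom x e).
Proof.
move=> e_ge0 Lx; apply: subring_prod => // i _; rewrite -(gez0_abs (e_ge0 i)) -exprnP.
case: (Lx i) => [->|]; last exact: subringX.
by rewrite expr0; exact: subring1.
Qed.

End InSubring.
End LaurentMonomials.

Definition pos_part (a : int) : int := Num.max a 0.

Lemma pos_part_id a : 0 <= a -> pos_part a = a.
Proof. by rewrite /pos_part; lia. Qed.

Lemma pos_part_eq0 a : a <= 0 -> pos_part a = 0.
Proof. by rewrite /pos_part; lia. Qed.

Lemma pos_part_ge0 a : 0 <= pos_part a.
Proof. by rewrite /pos_part; lia. Qed.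

Lemma half_norm_mul (a b : int) (s : bool) :
  ((`|a| * b + a * `|b|) %/ 2)%Z =
  pos_part (- (-1) ^+ s * a) * b + a * pos_part ((-1) ^+ s * b).
Proof.
have -> : `|a| * b + a * `|b| =
    (pos_part (- (-1) ^+ s * a) * b + a * pos_part ((-1) ^+ s * b)) * 2.
  rewrite /pos_part; case: s; rewrite ?expr0 ?expr1 ?opprK ?mul1r ?mulN1r; nia.
by rewrite mulzK.
Qed.

Section Seeds.
Variables (E : fieldType) (T : finType).
Implicit Types (x : T -> E) (B : T -> T -> int) (b : T -> int) (k : T) (s : bool).

Definition mu_mx k B : T -> T -> int := fun i j =>
  if (i == k) || (j == k) then - B i j
  else B i j + ((`|B i k| * B k j + B i k * `|B k j|) %/ 2)%Z.

Definition exchange x b : E :=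
  \prod_(i | 0 < b i) x i ^+ `|b i|%N + \prod_(i | b i < 0) x i ^+ `|b i|%N.

Definition mu_var k x B : T -> E := fun i =>
  if i == k then (x i)^-1 * exchange x (B^~ k) else x i.

Definition seed : Type := ((T -> E) * (T -> T -> int))%type.

Definition mu (S : seed) k : seed := (mu_var k S.1 S.2, mu_mx k S.2).

Definition mu_path (S : seed) (ks : seq T) : seed := foldl mu S ks.

Lemma mu_mx_row k B j : mu_mx k B k j = - B k j.
Proof. by rewrite /mu_mx eqxx. Qed.

Lemma mu_mx_col k B i : mu_mx k B i k = - B i k.
Proof. by rewrite /mu_mx eqxx orbT. Qed.

Lemma mu_mx_sign s k B i j : i != k -> j != k -> mu_mx k B i j =
  B i j + (pos_part (- (-1) ^+ s * B i k) * B k j + B i k * pos_part ((-1) ^+ s * B k j)).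
Proof. by rewrite /mu_mx => /negbTE -> /negbTE ->; rewrite -half_norm_mul. Qed.

Lemma mu_var_same k x B : mu_var k x B k = (x k)^-1 * exchange x (B^~ k).
Proof. by rewrite /mu_var eqxx. Qed.

Lemma mu_var_other k x B i : i != k -> mu_var k x B i = x i.
Proof. by rewrite /mu_var => /negbTE ->. Qed.

Lemma exchangeE x b : exchange x b =
  lmonom x (fun i => pos_part (b i)) + lmonom x (fun i => pos_part (- b i)).
Proof.
rewrite /exchange /lmonom big_mkcond [X in _ + X]big_mkcond /=.
congr (_ + _); apply: eq_bigr => i _; case: ifP => b_sign.
- by rewrite pos_part_id 1?ltW // -{2}(gtz0_abs b_sign) -exprnP.
- by rewrite pos_part_eq0 // leNgt b_sign.
- by rewrite pos_part_id ?oppr_ge0 1?ltW // -(ltz0_abs b_sign) -exprnP.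
- by rewrite pos_part_eq0 // oppr_le0 leNgt b_sign.
Qed.

Lemma subring_exchange (L : E -> Prop) x b :
  subring L -> (forall l, b l = 0 \/ L (x l)) -> L (exchange x b).
Proof.
move=> L_subring Lx; rewrite exchangeE.
apply: subringD => //; apply: subring_lmonom => // l; try exact: pos_part_ge0.
all: by case: (Lx l) => [->|]; [left | right].
Qed.

Lemma subring_mu_var (L : E -> Prop) k x B : subring L -> L (x k)^-1 ->
  (forall l, B l k = 0 \/ L (x l)) -> L (mu_var k x B k).
Proof.
by move=> L_subring LxV Lx; rewrite mu_var_same; apply: subringM => //; exact: subring_exchange.
Qed.

Lemma exchangeN x b : exchange x (fun i => - b i) = exchange x b.
Proof.
by rewrite !exchangeE addrC; congr (_ + _); apply: eq_lmonom => i; rewrite ?opprK.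
Qed.

Lemma eq_exchange x x' b b' :
  b =1 b' -> (forall i, b i != 0 -> x i = x' i) -> exchange x b = exchange x' b'.
Proof.
move=> bb' xx'; congr (_ + _); apply: eq_big => i; rewrite bb' // => b_sign;
  by congr (_ ^+ _); apply: xx'; rewrite bb' neq_lt b_sign ?orbT.
Qed.

(* Either of the two monomials can be factored out of the exchange polynomial. *)
Lemma exchange_sign s x b : (forall i, x i != 0) -> exchange x b =
  lmonom x (fun i => pos_part (- (-1) ^+ s * b i)) *
  (1 + lmonom x (fun i => (-1) ^+ s * b i)).
Proof.
move=> nx; rewrite mulrDr mulr1 -lmonomD // exchangeE.
case: s; rewrite ?expr0 ?expr1 ?opprK; last rewrite addrC.
all: by congr (_ + _); apply: eq_lmonom => i; rewrite /pos_part; lia.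
Qed.

Variable mut : pred T.

Definition skew_symmetrizable_on B : Prop := exists d : T -> int,
  (forall i, mut i -> 0 < d i) /\
  (forall i j, mut i -> mut j -> d i * B i j = - (d j * B j i)).

Lemma skew_symmetrizable_diag B i : skew_symmetrizable_on B -> mut i -> B i i = 0.
Proof. by case=> d [dp dB] mi; have := dB i i mi mi; have := dp i mi; nia. Qed.

Lemma skew_symmetrizable_mu B k :
  mut k -> skew_symmetrizable_on B -> skew_symmetrizable_on (mu_mx k B).
Proof.
move=> mk [d [dp dB]]; exists d; split=> // i j mi mj.
have [->|nik] := eqVneq i k; first by rewrite mu_mx_row mu_mx_col !mulrN dB.
have [->|njk] := eqVneq j k; first by rewrite mu_mx_row mu_mx_col !mulrN dB.
rewrite (@mu_mx_sign false k B i j) // (@mu_mx_sign false k B j i) //.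
rewrite expr0 !mul1r !mulN1r.
have dB_pos u v : mut u -> mut v -> d u * pos_part (- B u v) = d v * pos_part (B v u).
  by move=> mu mv; have := dB u v mu mv; have := dp u mu; have := dp v mv; rewrite /pos_part; nia.
have eij := dB i j mi mj; have eik := dB i k mi mk; have ekj := dB k j mk mj.
have pik := dB_pos i k mi mk; have pjk := dB_pos j k mj mk.
rewrite !mulrDr opprD eij !mulrA pik eik pjk; congr (_ + _).
rewrite !mulNr -!mulrA [d k * _]mulrCA ekj -[B k i * _]mulrC.
rewrite [d k * (_ * B k i)]mulrA -pjk; ring.
Qed.

Lemma mu_mxK B k : mut k -> skew_symmetrizable_on B -> mu_mx k (mu_mx k B) = B.
Proof.
move=> mk B_skew; apply: functional_extensionality => i.
apply: functional_extensionality => j.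
have [->|nik] := eqVneq i k; first by rewrite !mu_mx_row opprK.
have [->|njk] := eqVneq j k; first by rewrite !mu_mx_col opprK.
rewrite (@mu_mx_sign true) // (@mu_mx_sign false k B) // mu_mx_row mu_mx_col.
by rewrite expr0 expr1 !opprK !mul1r !mulN1r opprK; ring.
Qed.

Lemma exchange_mu_var x B k : mut k -> skew_symmetrizable_on B ->
  exchange (mu_var k x B) (B^~ k) = exchange x (B^~ k).
Proof.
move=> mk B_skew; apply: eq_exchange => // i nBik; rewrite mu_var_other //.
by apply: contraNneq nBik => ->; rewrite (skew_symmetrizable_diag B_skew mk).
Qed.

Lemma mu_var_involutive x B k : mut k -> skew_symmetrizable_on B ->
  mu_var k x B k != 0 -> mu_var k (mu_var k x B) B = x.
Proof.
move=> mk B_skew; rewrite mu_var_same mulf_eq0 invr_eq0 negb_or => /andP [nx nexch].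
apply: functional_extensionality => i.
have [->|nik] := eqVneq i k; last by rewrite !mu_var_other.
by rewrite mu_var_same exchange_mu_var // mu_var_same invfM invrK divfK.
Qed.

Lemma mu_var_mu_mx x B k : mu_var k x (mu_mx k B) = mu_var k x B.
Proof.
apply: functional_extensionality => i.
have [->|nik] := eqVneq i k; last by rewrite !mu_var_other.
rewrite !mu_var_same -[in RHS]exchangeN; congr (_ * _).
by apply: eq_exchange => // l; rewrite mu_mx_col.
Qed.

Definition reachable (S S' : seed) : Prop := exists2 ks, all mut ks & mu_path S ks = S'.

Definition nonvanishing (S : seed) : Prop :=
  forall S', reachable S S' -> forall i, S'.1 i != 0.

Lemma reachable_refl S : reachable S S. Proof. by exists [::]. Qed.

Lemma reachable_trans S1 S2 S3 : reachable S1 S2 -> reachable S2 S3 -> reachable S1 S3.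
Proof.
move=> [ks mks <-] [ls mls <-]; exists (ks ++ ls); rewrite ?all_cat ?mks //.
exact: foldl_cat.
Qed.

Lemma reachable_mu S k : mut k -> reachable S (mu S k).
Proof. by move=> mk; exists [:: k]; rewrite /= ?mk. Qed.

Lemma reachable_ind (P : seed -> Prop) S :
  P S -> (forall S' k, mut k -> reachable S S' -> P S' -> P (mu S' k)) ->
  forall S', reachable S S' -> P S'.
Proof.
move=> PS Pmu _ [ks mks <-]; elim/last_ind: ks mks => //= ks k IH.
rewrite all_rcons => /andP [mk mks]; rewrite /mu_path foldl_rcons.
by apply: Pmu => //; [exists ks | exact: IH].
Qed.

Lemma nonvanishing_reachable S S' : nonvanishing S -> reachable S S' -> nonvanishing S'.
Proof. by move=> nv rS S2 rS2; apply: nv; apply: reachable_trans rS2. Qed.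

Lemma skew_symmetrizable_reachable S S' :
  skew_symmetrizable_on S.2 -> reachable S S' -> skew_symmetrizable_on S'.2.
Proof.
move=> S_skew; move: S'; apply: reachable_ind => // S' k mk _.
exact: skew_symmetrizable_mu.
Qed.

Lemma reachable_frozen S S' i : reachable S S' -> ~~ mut i -> S'.1 i = S.1 i.
Proof.
move=> rS mi; move: S' rS; apply: reachable_ind => // S' k mk _ <-.
by rewrite /= mu_var_other //; apply: contraNneq mi => ->.
Qed.

Lemma lmonom_frozen S S' a : reachable S S' -> (forall i, mut i -> a i = 0) ->
  lmonom S'.1 a = lmonom S.1 a.
Proof.
move=> rS' a0; apply: eq_bigr => i _; have [mi|mi] := boolP (mut i).
  by rewrite a0 // !expr0z.
by rewrite (reachable_frozen rS' mi).
Qed.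

Lemma muK S k :
  mut k -> skew_symmetrizable_on S.2 -> nonvanishing S -> mu (mu S k) k = S.
Proof.
case: S => x B mk B_skew nv; rewrite /mu /= mu_mxK // mu_var_mu_mx mu_var_involutive //.
exact: (nv _ (reachable_mu (x, B) mk)).
Qed.

Lemma reachable_sym S S' :
  skew_symmetrizable_on S.2 -> nonvanishing S -> reachable S S' -> reachable S' S.
Proof.
move=> S_skew nvS; move: S'; apply: reachable_ind; first exact: reachable_refl.
move=> S' k mk rS'; apply: reachable_trans.
have S'_skew := skew_symmetrizable_reachable S_skew rS'.
have nvS' := nonvanishing_reachable nvS rS'.
by rewrite -[X in reachable _ X](muK mk S'_skew nvS'); apply: reachable_mu.
Qed.

End Seeds.

(** * Laurent rings and specialisations *)

Section LaurentRings.
Variables (R : comNzRingType) (E : fieldType) (T : finType).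
Variables (h : {rmorphism R -> E}) (inv : pred T).
Implicit Types (x : T -> E) (M : E -> Prop).

Definition laurent_ring x : E -> Prop := generated_ring (fun f =>
  [\/ exists c, f = h c, exists i, f = x i | exists2 i, inv i & f = (x i)^-1]).

Lemma subring_laurent_ring x : subring (laurent_ring x).
Proof. exact: subring_generated. Qed.

Lemma laurent_ring_const x c : laurent_ring x (h c).
Proof. by apply: generated_base; constructor 1; exists c. Qed.

Lemma laurent_ring_var x i : laurent_ring x (x i).
Proof. by apply: generated_base; constructor 2; exists i. Qed.

Lemma laurent_ring_varV x i : inv i -> laurent_ring x (x i)^-1.
Proof. by move=> ii; apply: generated_base; constructor 3; exists i. Qed.

Lemma laurent_ring_min x M f : subring M -> (forall c, M (h c)) -> (forall i, M (x i)) ->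
  (forall i, inv i -> M (x i)^-1) -> laurent_ring x f -> M f.
Proof.
move=> M_subring Mh Mx MxV; apply: generated_ring_min => // _ [[c ->]|[i ->]|[i ii ->]] //.
exact: MxV.
Qed.

Lemma laurent_ring_unit x i : inv i -> x i != 0 -> unit_in (laurent_ring x) (x i).
Proof. by move=> ii nx; split=> //; [exact: laurent_ring_var | exact: laurent_ring_varV]. Qed.

Lemma laurent_ring_clear_denom M x w f : subring M -> M w ->
  (forall c, M (h c)) -> (forall i, M (x i)) ->
  (forall i, inv i -> x i != 0 /\ M (w / x i)) -> laurent_ring x f -> localisation M w f.
Proof.
move=> M_subring Mw Mh Mx MxV; apply: laurent_ring_min; first exact: subring_localisation.
- by move=> c; apply: localisation_base.
- by move=> i; apply: localisation_base.
by move=> i /MxV [nx Mwx]; exists 1%N; rewrite expr1 mulrC.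
Qed.

End LaurentRings.

Definition int_laurent_ring (E : fieldType) (T : finType) (inv : pred T) (x : T -> E) :
    E -> Prop :=
  laurent_ring (intr : {rmorphism int -> E}) inv x.

Section Specialisation.
Variables (R : comNzRingType) (E1 E2 : fieldType).
Variables (phi : {rmorphism R -> E1}) (psi : {rmorphism R -> E2}).
Hypothesis phi_inj : injective phi.

(* [b] is the value at [a] of the place extending [phi p |-> psi p] to those fractions
   whose denominator is not killed by [psi]. *)
Definition specialises (a : E1) (b : E2) : Prop :=
  exists p q, [/\ psi q != 0, a = phi p / phi q & b = psi p / psi q].

Lemma specialised_neq0 p : psi p != 0 -> phi p != 0.
Proof. by apply: contraNneq; rewrite -(rmorph0 phi) => /phi_inj ->; rewrite rmorph0. Qed.

Lemma specialises_uniq a b b' : specialises a b -> specialises a b' -> b = b'.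
Proof.
case=> p [q [nq -> ->]] [p' [q' [nq' e ->]]].
have /phi_inj pq : phi (p * q') = phi (p' * q).
  rewrite !rmorphM; apply/eqP; rewrite -eqr_div ?specialised_neq0 //; exact/eqP.
by apply/eqP; rewrite eqr_div // -!rmorphM pq.
Qed.

Lemma specialises_morph p : specialises (phi p) (psi p).
Proof. by exists p, 1; rewrite !rmorph1 oner_neq0 !divr1. Qed.

Lemma specialises1 : specialises 1 1.
Proof. by have := specialises_morph 1; rewrite !rmorph1. Qed.

Lemma specialisesD a b c d :
  specialises a b -> specialises c d -> specialises (a + c) (b + d).
Proof.
case=> p [q [nq -> ->]] [p' [q' [nq' -> ->]]].
exists (p * q' + p' * q), (q * q'); rewrite !rmorphM mulf_neq0 //.
by split=> //; rewrite rmorphD !rmorphM addf_div ?specialised_neq0.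
Qed.

Lemma specialisesM a b c d :
  specialises a b -> specialises c d -> specialises (a * c) (b * d).
Proof.
case=> p [q [nq -> ->]] [p' [q' [nq' -> ->]]].
by exists (p * p'), (q * q'); rewrite !rmorphM mulf_neq0 // !mulf_div.
Qed.

Lemma specialisesV a b : specialises a b -> b != 0 -> specialises a^-1 b^-1.
Proof.
case=> p [q [nq -> ->]]; rewrite mulf_eq0 negb_or => /andP [np _].
by exists q, p; rewrite !invf_div.
Qed.

Lemma specialises_neq0 a b : specialises a b -> b != 0 -> a != 0.
Proof.
move=> ab; apply: contraNneq => a0; apply/eqP; apply: (specialises_uniq ab).
by have := specialises_morph 0; rewrite a0 !rmorph0.
Qed.

Lemma specialisesX a b k : specialises a b -> specialises (a ^+ k) (b ^+ k).
Proof.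
by move=> ab; elim: k => [|k IH]; rewrite ?exprS; [exact: specialises1 | exact: specialisesM].
Qed.

Lemma specialises_exprz a b (z : int) :
  specialises a b -> b != 0 \/ 0 <= z -> specialises (a ^ z) (b ^ z).
Proof.
case: z => k ab; first by move=> _; exact: specialisesX.
case=> // nb; rewrite !NegzE -!exprz_inv -!exprnP; apply: specialisesX.
exact: specialisesV.
Qed.

Variable T : finType.
Implicit Types (x : T -> E1) (v : T -> E2).

Lemma specialises_prod (P : pred T) x v :
  (forall i, P i -> specialises (x i) (v i)) ->
  specialises (\prod_(i | P i) x i) (\prod_(i | P i) v i).
Proof.
move=> xv; apply: (big_rec2 (fun a b => specialises a b)); first exact: specialises1.
by move=> i a b Pi; apply: specialisesM; apply: xv.
Qed.

Lemma specialises_lmonom x v e : (forall i, specialises (x i) (v i)) ->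
  (forall i, v i != 0 \/ 0 <= e i) -> specialises (lmonom x e) (lmonom v e).
Proof. by move=> xv ve; apply: specialises_prod => i _; apply: specialises_exprz. Qed.

Lemma specialises_exchange x v b :
  (forall i, specialises (x i) (v i)) -> specialises (exchange x b) (exchange v b).
Proof.
by move=> xv; apply: specialisesD; apply: specialises_prod => i _; apply: specialisesX.
Qed.

Lemma specialises_mu_path (mut : pred T) x v B ks :
  (forall i, specialises (x i) (v i)) ->
  (forall S', reachable mut (v, B) S' -> forall i, mut i -> S'.1 i != 0) ->
  all mut ks -> forall i, specialises ((mu_path (x, B) ks).1 i) ((mu_path (v, B) ks).1 i).
Proof.
elim: ks x v B => [|k ks IH] x v B xv nv //= /andP [mk mks].
apply: IH => // [i|S' rS'].
  rewrite /mu_var; case: eqP => // ->; apply: specialisesM; last exact: specialises_exchange.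
  by apply: specialisesV => //; apply: (nv _ (reachable_refl _ _)).
by apply: nv; apply: reachable_trans rS'; apply: (reachable_mu (v, B)).
Qed.

End Specialisation.

(** * The Laurent phenomenon *)

(* Mutate at [i], at [j] and again at [i], in the presence of a frozen variable [x t]
   that enters the exchange relation at [j] but not the one at [i]. Over a ring [L] in
   which the initial variables other than [x t] are invertible, the second and the third
   new variables are congruent to units modulo [x t]. *)
Section TwoStepExchange.
Variables (E : fieldType) (T : finType) (mut : pred T) (x : T -> E) (B : T -> T -> int).
Variables (i j t : T) (s : bool) (L Lt : E -> Prop).
Hypotheses (L_subring : subring L) (Lt_subring : subring Lt).
Hypotheses (LLt : forall a, L a -> Lt a) (Lt_t : Lt (x t)).
Hypothesis x_unit : forall l, l != t -> unit_in L (x l).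
Hypotheses (nv : nonvanishing mut (x, B)) (B_skew : skew_symmetrizable_on mut B).
Hypotheses (mi : mut i) (mj : mut j) (nij : i != j) (nit : i != t) (njt : j != t).
Hypotheses (Bti : B t i = 0) (Btj : B t j = (-1) ^+ s) (sBij : (-1) ^+ s * B i j <= 0).

Let sg : int := (-1) ^+ s.
Let x1 := mu_var i x B.
Let B1 := mu_mx i B.
Let x2 := mu_var j x1 B1.
Let B2 := mu_mx j B1.
Let x3 := mu_var i x2 B2.

Let nx l : x l != 0. Proof. exact: (nv (reachable_refl _ _)). Qed.
Let reach1 : reachable mut (x, B) (x1, B1). Proof. exact: (reachable_mu (x, B) mi). Qed.
Let reach2 : reachable mut (x, B) (x2, B2).
Proof. exact: reachable_trans reach1 (reachable_mu (x1, B1) mj). Qed.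
Let nx1 l : x1 l != 0. Proof. exact: (nv reach1). Qed.
Let nx2 l : x2 l != 0. Proof. exact: (nv reach2). Qed.
Let nji : j != i. Proof. by rewrite eq_sym. Qed.
Let nti : t != i. Proof. by rewrite eq_sym. Qed.
Let ntj : t != j. Proof. by rewrite eq_sym. Qed.

Let sg_sqr : sg * sg = 1. Proof. by rewrite -expr2 sqrr_sign. Qed.
Let B1ii : B1 i i = 0.
Proof. by rewrite /B1 mu_mx_row (skew_symmetrizable_diag B_skew) ?oppr0. Qed.
Let B1jj : B1 j j = 0.
Proof. exact: skew_symmetrizable_diag (skew_symmetrizable_mu mi B_skew) mj. Qed.
Let B1ti : B1 t i = 0. Proof. by rewrite /B1 mu_mx_col Bti oppr0. Qed.
Let B1tj : B1 t j = sg.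
Proof. by rewrite /B1 (@mu_mx_sign _ false) // Btj Bti mulr0 mul0r mul0r !addr0. Qed.
Let sB1ij : 0 <= sg * B1 i j. Proof. by rewrite /B1 mu_mx_row mulrN oppr_ge0. Qed.

Let sB1ji : sg * B1 j i <= 0.
Proof.
have [d [dp dB]] := B_skew; have := dB i j mi mj; have := dp i mi; have := dp j mj.
by move: sBij; rewrite /B1 mu_mx_col /sg; case: s; rewrite ?expr0 ?expr1; nia.
Qed.

Let x1_unit l : l != t -> l != i -> unit_in L (x1 l).
Proof. by move=> nlt nli; rewrite /x1 mu_var_other //; apply: x_unit. Qed.

Let Lt_x1i : Lt (x1 i).
Proof.
apply: subring_mu_var => // [|l]; first by apply: LLt; case: (x_unit nit).
by have [->|/x_unit [_ Lx _]] := eqVneq l t; [left | right; apply: LLt].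
Qed.

Let exp2 l := pos_part (- sg * B1 l j).
Let const2 := (x j)^-1 * lmonom x1 exp2.
Let deg := absz (sg * B1 j i).

Let exp2_t : exp2 t = 0. Proof. by rewrite /exp2 B1tj mulNr sg_sqr. Qed.
Let exp2_i : exp2 i = 0. Proof. by rewrite /exp2 pos_part_eq0 // mulNr oppr_le0. Qed.
Let degE : deg%:Z = - (sg * B1 j i). Proof. by rewrite /deg; lia. Qed.

Let const2_unit : unit_in L const2.
Proof.
apply: unit_inM => //; first by apply: unit_inV; apply: x_unit.
apply: unit_in_lmonom => // l.
have [->|nlt] := eqVneq l t; first by left.
by have [->|nli] := eqVneq l i; [left | right; apply: x1_unit].
Qed.

Lemma second_exchange_eqmod : eqmod_in L (x t * x1 i ^ (sg * B1 i j)) (x2 j) const2.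
Proof.
pose f l := sg * B1 l j.
exists (const2 * lmonom x1 (erase i (erase t f))).
  apply: subringM => //; first by case: const2_unit.
  apply: unit_in_mem; apply: unit_in_lmonom => // l; rewrite /erase.
  have [->|nli] := eqVneq l i; first by left.
  by have [->|nlt] := eqVneq l t; [left | right; apply: x1_unit].
rewrite {1}/x2 mu_var_same (exchange_sign s) // mulrA [x1 j]mu_var_other // -/const2.
rewrite mulrDr mulr1; congr (_ + _); rewrite mulrCA; congr (_ * _).
rewrite (lmonom_erase t) (lmonom_erase i _ (erase t _)) mulrA.
rewrite erase_other // /f B1tj sg_sqr expr1z.
by rewrite [x1 t]mu_var_other.
Qed.

Lemma second_exchangeX_eqmod : eqmod_in Lt (x1 i * x t) (x2 j ^+ deg) (const2 ^+ deg).
Proof.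
have Lt_const2 : Lt const2 by apply: LLt; case: const2_unit.
have [B1ij0|nB1ij] := eqVneq (B1 i j) 0.
  have B1ji0 : B1 j i = 0.
    have [d [dp dB]] := skew_symmetrizable_mu mi B_skew.
    by have := dB i j mi mj; have := dp j mj; rewrite -/B1 B1ij0; nia.
  by exists 0; rewrite /deg ?B1ji0 ?mulr0 ?addr0 //; exact: subring0.
apply: eqmod_inX => //; first exact: subringM.
have [e eE] : exists e : nat, sg * B1 i j = e.+1%:Z.
  exists (absz (sg * B1 i j)).-1; move: nB1ij sB1ij.
  by rewrite /sg; case: s; rewrite ?expr0 ?expr1; lia.
apply: (@eqmod_in_divisor _ _ _ _ (x1 i ^+ e)) => //; first exact: subringX.
have [u Lu ->] := second_exchange_eqmod.
exists u; first exact: LLt.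
by rewrite eE -exprnP exprS mulrCA mulrA.
Qed.

Let B2E l : l != j -> B2 l i = B1 l i + exp2 l * B1 j i.
Proof.
by move=> nlj; rewrite /B2 (mu_mx_sign s) // (pos_part_eq0 sB1ji) mulr0 addr0.
Qed.

Let B2ji : B2 j i = - B1 j i. Proof. by rewrite /B2 mu_mx_row. Qed.
Let B2ii : B2 i i = 0. Proof. by rewrite B2E // B1ii exp2_i mul0r. Qed.
Let B2ti : B2 t i = 0. Proof. by rewrite B2E // B1ti exp2_t mul0r. Qed.

Let cofactor := lmonom x2 (erase j (fun l => sg * B2 l i)).
Let back_monom := lmonom x1 (fun l => pos_part (- sg * B1 l i)).
Let third_monom := lmonom x2 (fun l => pos_part (- sg * B2 l i)).

Let x2_unit l : [\/ l = t, l = i, l = j | unit_in L (x2 l)].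
Proof.
have [->|nlt] := eqVneq l t; first exact: Or41.
have [->|nli] := eqVneq l i; first exact: Or42.
have [->|nlj] := eqVneq l j; first exact: Or43.
by apply: Or44; rewrite /x2 mu_var_other //; apply: x1_unit.
Qed.

Let cofactor_unit : unit_in L cofactor.
Proof.
apply: unit_in_lmonom => // l; rewrite /erase.
case: (x2_unit l) => [->|->|->|]; try by right.
all: by left; rewrite ?eqxx ?B2ti ?B2ii ?mulr0 ?if_same.
Qed.

Let back_monom_unit : unit_in L back_monom.
Proof.
apply: unit_in_lmonom => // l.
have [->|nlt] := eqVneq l t; first by left; rewrite B1ti mulr0.
by have [->|nli] := eqVneq l i; [left; rewrite B1ii mulr0 | right; apply: x1_unit].
Qed.

Let third_monom_unit : unit_in L third_monom.
Proof.
apply: unit_in_lmonom => // l; case: (x2_unit l) => [->|->|->|]; try by right.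
- by left; rewrite B2ti mulr0.
- by left; rewrite B2ii mulr0.
- by left; rewrite B2ji mulrNN pos_part_eq0.
Qed.

Lemma second_exchange_constant_term : cofactor * const2 ^+ deg = lmonom x1 (fun l => sg * B1 l i).
Proof.
have -> : const2 = lmonom x1 (fun l => exp2 l - delta j l).
  by rewrite lmonomD // lmonomN lmonom_delta mulrC [x1 j]mu_var_other.
have -> : cofactor = lmonom x1 (erase j (fun l => sg * B2 l i)).
  by apply: eq_lmonom_erase => l nlj; rewrite /x2 mu_var_other.
rewrite -lmonomX -lmonomD //; apply: eq_lmonom => l; rewrite /erase /delta degE.
have [->|nlj] := eqVneq l j; last first.
  by rewrite B2E // subr0 mulrDr mulrN [sg * (exp2 l * _)]mulrCA addrK.
by rewrite /exp2 B1jj mulr0 pos_part_eq0 // sub0r mulrNN mul1r add0r.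
Qed.

Lemma first_exchange_reversed : 1 + lmonom x1 (fun l => sg * B1 l i) = x1 i * x i / back_monom.
Proof.
have -> : x i = mu_var i x1 B1 i.
  by rewrite /B1 mu_var_mu_mx (mu_var_involutive mi B_skew) //; exact: nx1.
rewrite mu_var_same (exchange_sign s) // -/back_monom mulVKf //.
by rewrite mulrC mulKf // lmonom_neq0.
Qed.

Lemma third_exchange_eqmod : eqmod_in Lt (x t) (x3 i) (third_monom * (x i / back_monom)).
Proof.
have -> : x3 i = third_monom * ((x1 i)^-1 * (1 + cofactor * x2 j ^+ deg)).
  rewrite /x3 mu_var_same (exchange_sign s) // -/third_monom [x2 i]mu_var_other // mulrCA.
  rewrite (lmonom_erase j) -/cofactor B2ji mulrN -degE -exprnP.
  by rewrite [cofactor * _]mulrC.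
have -> : x i / back_monom = (x1 i)^-1 * (1 + cofactor * const2 ^+ deg).
  by rewrite second_exchange_constant_term first_exchange_reversed -mulrA mulKf.
apply: eqmod_inMl => //; first by apply: LLt; case: third_monom_unit.
rewrite -[x t](mulKf (nx1 i)); apply/eqmod_in_scale/eqmod_inDl/eqmod_inMl => //.
  by apply: LLt; case: cofactor_unit.
exact: second_exchangeX_eqmod.
Qed.

Lemma two_step_exchange : exists u2 u3,
  [/\ unit_in L u2, unit_in L u3, eqmod_in Lt (x t) (x2 j) u2 & eqmod_in Lt (x t) (x3 i) u3].
Proof.
exists const2, (third_monom * (x i / back_monom)); split=> //; last exact: third_exchange_eqmod.
  by do !apply: unit_inM => //; [exact: x_unit | exact: unit_inV].
apply: (@eqmod_in_divisor _ _ _ _ (x1 i ^ (sg * B1 i j))) => //.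
  by rewrite -(gez0_abs sB1ij) -exprnP; apply: subringX.
by have [c Lc ->] := second_exchange_eqmod; exists c => //; exact: LLt.
Qed.

End TwoStepExchange.

Lemma tofrac_inj (R : idomainType) : injective (@tofrac R).
Proof. by move=> p q /eqP; rewrite tofrac_eq => /eqP. Qed.

Section PolynomialsOverSubring.
Variables (E : fieldType) (M : E -> Prop).
Hypothesis M_subring : subring M.
Implicit Types (g p v : {poly E}) (f : {fraction {poly E}}).

Definition coefs_in p : Prop := forall k, M p`_k.

Lemma coefs_in_polyC a : M a -> coefs_in a%:P.
Proof. by move=> Ma k; rewrite coefC; case: eqP => // _; exact: subring0. Qed.

Lemma coefs_in_polyX : coefs_in 'X.
Proof. by move=> k; rewrite coefX; exact: (subring_int M_subring (k == 1)%N). Qed.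

Lemma subring_coefs_in : subring coefs_in.
Proof.
split=> [|p q Mp Mq k|p Mp k|p q Mp Mq k].
- by apply: coefs_in_polyC; exact: subring1.
- by rewrite coefD; exact: subringD.
- by rewrite coefN; exact: subringN.
- by rewrite coefM; apply: subring_sum => // l _; exact: subringM.
Qed.

Lemma coefs_in_horner p a : coefs_in p -> M a -> M p.[a].
Proof.
move=> Mp Ma; rewrite horner_coef; apply: subring_sum => // k _.
by apply: subringM => //; exact: subringX.
Qed.

Lemma coefs_in_mulXn p N : coefs_in (p * 'X^N) -> coefs_in p.
Proof. by move=> MpX k; have := MpX (k + N)%N; rewrite coefMXn ltnNge leq_addl addnK. Qed.

Lemma coefs_in_cancel g v :
  coefs_in v -> unit_in M v`_0 -> coefs_in (g * v) -> coefs_in g.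
Proof.
move=> Mv [nv0 _ Mv0V] Mgv k; have [n] := ubnP k; elim: n k => // n IH k /ltnSE lekn.
have gkE : g`_k = ((g * v)`_k - \sum_(l < k) g`_l * v`_(k - l)) / v`_0.
  by rewrite coefM big_ord_recr /= subnn addrAC subrr add0r mulfK.
rewrite gkE; apply: subringM => //; apply: subringD => //; apply: subringN => //.
apply: subring_sum => // l _; apply: subringM => //.
exact: IH (leq_trans (ltn_ord l) lekn).
Qed.

Definition poly_unit_at0 v : Prop := coefs_in v /\ unit_in M v`_0.

Lemma poly_unit_at0M v w : poly_unit_at0 v -> poly_unit_at0 w -> poly_unit_at0 (v * w).
Proof.
move=> [Mv v0] [Mw w0]; split; first exact: (subringM subring_coefs_in).
by rewrite coefM big_ord1; apply: unit_inM.
Qed.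

Lemma poly_unit_at0X v N : poly_unit_at0 v -> poly_unit_at0 (v ^+ N).
Proof.
move=> v_unit; elim: N => [|N IH]; last by rewrite exprS; apply: poly_unit_at0M.
split; first exact: (subring1 subring_coefs_in).
by rewrite coef1; exact: unit_in1.
Qed.

Definition const_frac : {rmorphism E -> {fraction {poly E}}} := @tofrac _ \o @polyC E.

Definition poly_in : {fraction {poly E}} -> Prop := image_in (@tofrac {poly E}) coefs_in.

Lemma subring_poly_in : subring poly_in.
Proof. exact: subring_image subring_coefs_in. Qed.

Lemma poly_in_const f : image_in const_frac M f -> poly_in f.
Proof. by case=> a Ma ->; exists a%:P => //; exact: coefs_in_polyC. Qed.

Lemma poly_in_var : poly_in (tofrac 'X).
Proof. by exists 'X => //; exact: coefs_in_polyX. Qed.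

Lemma unit_in_const a : unit_in M a -> unit_in (image_in const_frac M) (const_frac a).
Proof.
by case=> na Ma MaV; split; rewrite ?fmorph_eq0 -?fmorphV //; [exists a | exists a^-1].
Qed.

Lemma poly_unit_at0_eqmod f a : unit_in (image_in const_frac M) a ->
  eqmod_in poly_in (tofrac 'X) f a -> exists2 v, poly_unit_at0 v & f = tofrac v.
Proof.
case=> na [b Mb aE] [b' Mb' bE'] [_ [p Mp ->] fE].
exists (b%:P + 'X * p); last by rewrite fE aE tofracD tofracM.
split.
  apply: (subringD subring_coefs_in); first exact: coefs_in_polyC.
  by apply: (subringM subring_coefs_in) => //; exact: coefs_in_polyX.
rewrite coefD coefC coefXM addr0 /=; split=> //.
  by apply: contraNneq na => b0; rewrite aE b0 rmorph0.
by move: bE'; rewrite aE -fmorphV => /fmorph_inj ->.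
Qed.

(* The denominator [c] is free of ['X] and the constant term of [v] is invertible, so that
   [c] and [v] are coprime over [M]. *)
Lemma localisation_coprime f c v : c != 0 -> poly_unit_at0 v ->
  localisation poly_in (tofrac (c%:P * 'X)) f -> localisation poly_in (tofrac (v * 'X)) f ->
  localisation poly_in (tofrac 'X) f.
Proof.
move=> nc v_unit [N [g Mg gE]] [k [p Mp pE]].
have cVcN : tofrac (c ^- N)%:P * tofrac c%:P ^+ N = 1 :> {fraction {poly E}}.
  by rewrite -tofracXn -polyC_exp -tofracM -polyCM mulVf ?expf_neq0 // polyC1 tofrac1.
have fXE : f * tofrac 'X ^+ N = tofrac ((c ^- N)%:P * g).
  by rewrite tofracM -gE tofracM exprMn mulrCA [X in _ = _ * X]mulrA cVcN mul1r.
exists N; exists ((c ^- N)%:P * g) => //.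
have [Mvk vk0] := poly_unit_at0X k v_unit; apply: (coefs_in_cancel Mvk vk0).
apply: (@coefs_in_mulXn _ k).
have -> : (c ^- N)%:P * g * v ^+ k * 'X^k = p * 'X^N.
  apply: tofrac_inj; rewrite -mulrA -exprMn tofracM -fXE mulrAC tofracXn pE.
  by rewrite tofracM tofracXn.
by apply: (subringM subring_coefs_in) => //; apply: (subringX subring_coefs_in);
  exact: coefs_in_polyX.
Qed.

End PolynomialsOverSubring.

Lemma big_option (R : Type) (idx : R) (op : Monoid.com_law idx) (T : finType)
  (G : option T -> R) :
  \big[op/idx]_o G o = op (G None) (\big[op/idx]_k G (Some k)).
Proof.
rewrite (bigD1 None) //=; congr (op _ _); rewrite (reindex_omap Some id) /=; last by case.
by apply: eq_bigl => k; rewrite eqxx.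
Qed.

Section AddedFrozenVariable.
Variables (T : finType) (mut : pred T).
Implicit Types (B : T -> T -> int) (j : T) (c : int).

Definition add_row B j c : option T -> option T -> int := fun a b =>
  match a, b with
  | Some k, Some l => B k l
  | None, Some l => if l == j then c else 0
  | _, None => 0
  end.

Lemma skew_symmetrizable_add_row B j c : skew_symmetrizable_on mut B ->
  skew_symmetrizable_on (oapp mut false) (add_row B j c).
Proof.
case=> d [dp dB]; exists (oapp d 1); split; first by case=> // k; apply: dp.
by case=> // k; case=> // l; apply: dB.
Qed.

Lemma all_oapp_map (os : seq (option T)) : all (oapp mut false) os ->
  exists2 ks, all mut ks & os = map Some ks.
Proof.
elim: os => [|[k|] os IH] //=; first by exists [::].
by case/andP=> mk /IH [ks mks ->]; exists (k :: ks); rewrite //= mk.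
Qed.

Variable E : fieldType.

Definition extends_by_one (So : seed E (option T)) (S : seed E T) : Prop :=
  [/\ So.1 None = 1, forall k, So.1 (Some k) = S.1 k &
      forall k l, So.2 (Some k) (Some l) = S.2 k l].

Lemma extends_by_one_mu So S k :
  extends_by_one So S -> extends_by_one (mu So (Some k)) (mu S k).
Proof.
case=> x1 xE BE; split=> //= [l|a b]; last first.
  by rewrite /mu_mx -[Some a == Some k]/(a == k) -[Some b == Some k]/(b == k) !BE.
rewrite /mu_var -[Some l == Some k]/(l == k) xE; case: eqP => // _.
congr (_ * _); rewrite !exchangeE /lmonom !big_option /= x1 !exp1rz !mul1r.
by congr (_ + _); apply: eq_bigr => r _; rewrite xE BE.
Qed.

Lemma extends_by_one_mu_path So S ks :
  extends_by_one So S -> extends_by_one (mu_path So (map Some ks)) (mu_path S ks).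
Proof. by elim: ks So S => //= k ks IH So S ext; apply: IH; apply: extends_by_one_mu. Qed.

End AddedFrozenVariable.

(* The variable [t] of [E(t)] is adjoined to a seed over [E] as a frozen variable; the
   specialisation [t := 1] recovers the original seed. *)
Section SeedWithVariable.
Variables (E : fieldType) (T : finType) (mut : pred T) (x : T -> E) (B : T -> T -> int).
Hypotheses (B_skew : skew_symmetrizable_on mut B) (nv : nonvanishing mut (x, B)).

Definition var_seed j c : seed {fraction {poly E}} (option T) :=
  (oapp (fun k => const_frac E (x k)) (tofrac 'X), add_row B j c).

Lemma one_seed_mu_path j c ks : all mut ks ->
  let So := mu_path (oapp x 1, add_row B j c) (map Some ks) in
  (forall k, So.1 (Some k) = (mu_path (x, B) ks).1 k) /\ forall o, So.1 o != 0.
Proof.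
move=> mks; have [|x1 xE _] := @extends_by_one_mu_path T E (oapp x 1, add_row B j c) (x, B) ks.
  by split.
split=> // -[k|]; last by rewrite x1 oner_neq0.
by rewrite xE; apply: nv; exists ks.
Qed.

Lemma specialises_var_seed j c ks o : all mut ks ->
  specialises (@tofrac {poly E}) (horner_eval 1)
    ((mu_path (var_seed j c) (map Some ks)).1 o)
    ((mu_path (oapp x 1, add_row B j c) (map Some ks)).1 o).
Proof.
move=> mks; apply: (@specialises_mu_path _ _ _ _ _ (@tofrac_inj {poly E}) _ (oapp mut false)).
- case=> [k|] /=.
    have := specialises_morph (@tofrac {poly E}) (horner_eval 1) (x k)%:P.
    by rewrite /= /horner_eval hornerC.
  have := specialises_morph (@tofrac {poly E}) (horner_eval 1) 'X.
  by rewrite /= /horner_eval hornerX.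
- by move=> _ [_ /all_oapp_map [ls mls ->] <-] i _; have [_] := one_seed_mu_path j c mls.
- by rewrite all_map.
Qed.

Lemma nonvanishing_var_seed j c : nonvanishing (oapp mut false) (var_seed j c).
Proof.
move=> _ [_ /all_oapp_map [ks mks ->] <-] o.
apply: (specialises_neq0 (@tofrac_inj {poly E}) (specialises_var_seed j c o mks)).
by have [_] := one_seed_mu_path j c mks.
Qed.

Variable M : E -> Prop.
Hypotheses (M_subring : subring M) (x_unit : forall k, unit_in M (x k)).

Lemma localisation_var_seed j c ks k : all mut ks ->
  localisation (poly_in M) (tofrac 'X) ((mu_path (var_seed j c) (map Some ks)).1 (Some k)) ->
  M ((mu_path (x, B) ks).1 k).
Proof.
move=> mks [N [g Mg gE]]; have [<- _] := one_seed_mu_path j c mks.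
have spec := specialises_var_seed j c (Some k) mks.
have specX := specialises_morph (@tofrac {poly E}) (horner_eval 1) 'X.
have := specialisesM spec (specialisesX N specX).
rewrite gE => /(specialises_uniq (@tofrac_inj {poly E}) (specialises_morph _ _ _)).
rewrite /= /horner_eval hornerX expr1n mulr1 => <-.
by apply: coefs_in_horner => //; exact: subring1.
Qed.

Section ThreeMutations.
Variables (i j : T).
Hypotheses (mi : mut i) (mj : mut j) (nij : i != j).

(* The sign puts [t] and the first new variable into the same monomial of the exchange
   relation at [j]. *)
Let S0 : seed {fraction {poly E}} (option T) := var_seed j ((-1) ^+ (0 <= B i j)%R).
Let S1 := mu S0 (Some i).
Let S2 := mu S1 (Some j).
Let S3 := mu S2 (Some i).

Let reach1 : reachable (oapp mut false) S0 S1. Proof. exact: reachable_mu. Qed.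
Let reach2 : reachable (oapp mut false) S0 S2.
Proof. exact: reachable_trans reach1 (reachable_mu S1 (k := Some j) mj). Qed.
Let reach3 : reachable (oapp mut false) S0 S3.
Proof. exact: reachable_trans reach2 (reachable_mu S2 (k := Some i) mi). Qed.
Let S0_skew : skew_symmetrizable_on (oapp mut false) S0.2.
Proof. exact: skew_symmetrizable_add_row. Qed.
Let nvS0 : nonvanishing (oapp mut false) S0. Proof. exact: nonvanishing_var_seed. Qed.

Let sBij : (-1) ^+ (0 <= B i j)%R * B i j <= 0.
Proof. by case: (lerP 0 (B i j)) => Bij; rewrite ?expr1 ?expr0; lia. Qed.

Let var_unit o : o != None -> unit_in (image_in (const_frac E) M) (S0.1 o).
Proof. by case: o => // k _; apply: unit_in_const. Qed.

Let poly_in_old o : o != None -> poly_in M (S0.1 o) /\ poly_in M (S0.1 o)^-1.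
Proof. by move=> /var_unit [_ Mo MoV]; split; apply: poly_in_const. Qed.

Lemma first_mutation_const : image_in (const_frac E) M (S1.1 (Some i)).
Proof.
have C_subring := subring_image (const_frac E) M_subring.
apply: (@subring_mu_var _ _ (image_in (const_frac E) M)) => // [|[k|]].
- by have [_ _] := var_unit (o := Some i) isT.
- by right; have [_ xk _] := var_unit (o := Some k) isT.
- by left; rewrite /= (negbTE nij).
Qed.

Lemma later_mutation_polys : exists v2 v3, [/\ poly_unit_at0 M v2, poly_unit_at0 M v3,
  S2.1 (Some j) = tofrac v2 & S3.1 (Some i) = tofrac v3].
Proof.
have [] := @two_step_exchange _ _ (oapp mut false) S0.1 S0.2 (Some i) (Some j) None
  (0 <= B i j) (image_in (const_frac E) M) (poly_in M).
all: rewrite //= ?(negbTE nij) ?eqxx //.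
- exact: subring_image.
- exact: subring_poly_in.
- exact: poly_in_const.
- exact: poly_in_var.
move=> a2 [a3 [u2 u3 e2 e3]].
have [v2 v2_unit v2E] := poly_unit_at0_eqmod M_subring u2 e2.
have [v3 v3_unit v3E] := poly_unit_at0_eqmod M_subring u3 e3.
by exists v2, v3.
Qed.

Let S1_old o : o != Some i -> S1.1 o = S0.1 o.
Proof. exact: mu_var_other. Qed.

Let S3_old o : o != Some i -> S3.1 o = S2.1 o.
Proof. exact: mu_var_other. Qed.

Let S2_old o : o != Some i -> o != Some j -> S2.1 o = S0.1 o.
Proof. by move=> noi noj; rewrite [LHS]mu_var_other ?S1_old. Qed.

Let clear_old_var (w : {poly E}) o : poly_in M (tofrac w) -> o != None ->
  poly_in M (S0.1 o) /\ poly_in M (tofrac w / S0.1 o).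
Proof.
move=> Mw /poly_in_old [Mo MoV]; split=> //.
exact: (subringM (subring_poly_in M_subring)).
Qed.

Let clear_denominators S w f : reachable (oapp mut false) S0 S -> poly_in M (tofrac w) ->
  (forall o, poly_in M (S.1 o) /\ poly_in M (tofrac w / S.1 o)) ->
  int_laurent_ring predT S.1 f -> localisation (poly_in M) (tofrac w) f.
Proof.
move=> rS Mw clear_var; have P_subring := subring_poly_in M_subring.
apply: laurent_ring_clear_denom => // [z|o|o _]; first exact: subring_int.
  by case: (clear_var o).
by split; [exact: nvS0 | case: (clear_var o)].
Qed.

Lemma first_mutation_localisation c f : M c -> S1.1 (Some i) = tofrac c%:P ->
  int_laurent_ring predT S1.1 f -> localisation (poly_in M) (tofrac (c%:P * 'X)) f.
Proof.
move=> Mc S1i; have P_subring := subring_poly_in M_subring.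
have Mc' : poly_in M (tofrac c%:P) by apply: poly_in_const => //; exists c.
have MX := poly_in_var M_subring.
have McX : poly_in M (tofrac (c%:P * 'X)) by rewrite tofracM; apply: subringM.
apply: clear_denominators => // o; have := nvS0 reach1 o.
have [->|noi] := eqVneq o (Some i).
  by rewrite S1i => nc; rewrite tofracM mulrAC mulfV // mul1r.
rewrite S1_old //; case: o noi => [k|] _ no; first exact: clear_old_var.
by rewrite tofracM mulfK.
Qed.

Lemma third_mutation_localisation v2 v3 f : poly_unit_at0 M v2 -> poly_unit_at0 M v3 ->
  S2.1 (Some j) = tofrac v2 -> S3.1 (Some i) = tofrac v3 ->
  int_laurent_ring predT S3.1 f -> localisation (poly_in M) (tofrac (v2 * v3 * 'X)) f.
Proof.
move=> [Mv2 _] [Mv3 _] S2j S3i; have P_subring := subring_poly_in M_subring.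
have Mv2' : poly_in M (tofrac v2) by exists v2.
have Mv3' : poly_in M (tofrac v3) by exists v3.
have MX := poly_in_var M_subring.
have Mw : poly_in M (tofrac (v2 * v3 * 'X)) by rewrite !tofracM; do !apply: subringM => //.
apply: clear_denominators => // o; have := nvS0 reach3 o.
have [->|noi] := eqVneq o (Some i).
  rewrite S3i => nv3; rewrite !tofracM mulrAC mulfK //.
  by split=> //; apply: subringM.
rewrite S3_old //; have [->|noj] := eqVneq o (Some j).
  rewrite S2j => nv2; rewrite !tofracM mulrAC [tofrac v2 * _]mulrC mulfK //.
  by split=> //; apply: subringM.
rewrite S2_old //; case: o noi noj => [k|] _ _ no; first exact: clear_old_var.
by rewrite tofracM mulfK // tofracM; split=> //; apply: subringM.
Qed.

Lemma laurent_step rest k : all mut rest ->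
  (forall S js o, reachable (oapp mut false) S0 S -> all mut js ->
     size js = (size rest).+1 ->
     int_laurent_ring predT S.1 ((mu_path S (map Some js)).1 o)) ->
  M ((mu_path (x, B) [:: i, j & rest]).1 k).
Proof.
move=> mrest shorter; apply: (localisation_var_seed (j := j)); first by rewrite /= mi mj.
have [c Mc S1i] := first_mutation_const.
have [v2 [v3 [v2_unit v3_unit S2j S3i]]] := later_mutation_polys.
apply: (localisation_coprime M_subring (c := c)) (poly_unit_at0M M_subring v2_unit v3_unit) _ _.
- have := nvS0 reach1 (Some i); rewrite S1i; apply: contraNneq => ->.
  by rewrite rmorph0.
- apply: first_mutation_localisation => //.
  by apply: (shorter S1 (j :: rest)) => //=; rewrite mj.
apply: third_mutation_localisation => //.
have S3E : mu S3 (Some i) = S2.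
  apply: (@muK _ _ (oapp mut false)) => //; first exact: skew_symmetrizable_reachable reach2.
  exact: nonvanishing_reachable reach2.
have -> : mu_path S0 (map Some [:: i, j & rest]) = mu_path S3 (map Some (i :: rest)).
  by rewrite /= S3E.
by apply: (shorter S3 (i :: rest)) => //=; rewrite mi.
Qed.

End ThreeMutations.
End SeedWithVariable.

(* Induction on the length of the mutation path over all seeds at once, because the
   induction step enlarges the seed by a frozen variable. *)
Theorem laurent_phenomenon (E : fieldType) (T : finType) (mut : pred T) (S S' : seed E T) i :
  skew_symmetrizable_on mut S.2 -> nonvanishing mut S -> reachable mut S S' ->
  int_laurent_ring predT S.1 (S'.1 i).
Proof.
move=> S_skew nvS [ks mks <-] {S'}; have [N] := ubnP (size ks).
elim: N E T mut S S_skew nvS ks mks i => // N IH E T mut [x B] B_skew nv.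
have x_unit k : unit_in (int_laurent_ring predT x) (x k).
  by apply: laurent_ring_unit => //; apply: (nv _ (reachable_refl _ _)).
have L_subring := subring_laurent_ring (intr : {rmorphism int -> E}) predT x.
case=> [_ k _|i [/andP [mi _] k _|j rest /and3P [mi mj mrest] k /ltnSE size_rest]].
- by case: (x_unit k).
- have [->|nki] := eqVneq k i; last by rewrite /= mu_var_other //; case: (x_unit k).
  by apply: subring_mu_var => // [|l]; [case: (x_unit i) | right; case: (x_unit l)].
have [ij|nij] := eqVneq i j.
  by rewrite -ij /= (muK mi B_skew nv); apply: (IH _ _ mut (x, B)) => //; exact: ltnW.
apply: (laurent_step B_skew nv L_subring x_unit mi mj nij k mrest) => S js o rS mjs size_js.
apply: (IH _ _ (oapp mut false)); rewrite ?all_map ?size_map ?size_js //.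
  by apply: skew_symmetrizable_reachable rS; exact: skew_symmetrizable_add_row.
by apply: nonvanishing_reachable rS; exact: nonvanishing_var_seed.
Qed.

(** * Algebraically independent variables *)

Section MultivariatePolynomials.
Variables (R : idomainType) (n : nat).
Implicit Types (p q r : {mpoly R[n]}) (g : 'X_{1..n}) (k : 'I_n).

Lemma mpoly_ring_ind (P : {mpoly R[n]} -> Prop) :
  (forall c, P c%:MP) -> (forall i, P 'X_i) ->
  (forall p q, P p -> P q -> P (p + q)) -> (forall p q, P p -> P q -> P (p * q)) ->
  forall p, P p.
Proof.
move=> PC PX PD PM p.
have P0 : P 0 by rewrite -(mpolyC0 n).
have P1 : P 1 by rewrite -(mpolyC1 n).
rewrite (mpolyE p); apply: (big_ind P) => // g _.
rewrite -mul_mpolyC mpolyXE_id; apply: (PM) => //; apply: (big_ind P) => // i _.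
by elim: (g i) => [|d IH]; rewrite ?expr0 ?exprS //; apply: PM.
Qed.

Definition kill_var k : {rmorphism {mpoly R[n]} -> {mpoly R[n]}} :=
  mmap (@mpolyC n R) (fun i => if i == k then 0 else 'X_i).

Lemma kill_varC k c : kill_var k c%:MP = c%:MP.
Proof. exact: mmapC. Qed.

Lemma kill_varX k i : kill_var k 'X_i = if i == k then 0 else 'X_i.
Proof. by rewrite /kill_var /= mmapX mmap1U. Qed.

Lemma kill_var_eq0 k p : kill_var k p = 0 -> exists q, p = 'X_k * q.
Proof.
suff [q e] : exists q, p = kill_var k p + 'X_k * q by exists q; rewrite e H add0r.
elim/mpoly_ring_ind: p => [c|i|p p' [q e] [q' e']|p p' [q e] [q' e']].
- by exists 0; rewrite kill_varC mulr0 addr0.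
- rewrite kill_varX; case: eqP => [->|_]; first by exists 1; rewrite add0r mulr1.
  by exists 0; rewrite mulr0 addr0.
- by exists (q + q'); rewrite rmorphD mulrDr addrACA -e -e'.
- exists (kill_var k p * q' + q * p'); rewrite rmorphM.
  by move: (kill_var k p) (kill_var k p') e e' => a b -> ->; ring.
Qed.

Lemma mpolyX_prime k p q r :
  p * q = 'X_k * r -> (exists p', p = 'X_k * p') \/ (exists q', q = 'X_k * q').
Proof.
move=> /(congr1 (kill_var k)); rewrite !rmorphM kill_varX eqxx mul0r => /eqP.
by rewrite mulf_eq0 => /orP [] /eqP /kill_var_eq0; auto.
Qed.

Lemma mpolyX_neq0 g : 'X_[g] != 0 :> {mpoly R[n]}.
Proof. by rewrite -msupp_eq0 msuppX. Qed.

Lemma mnm_neq0_var g : g != 0%MM -> exists k g', g = (U_(k) + g')%MM.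
Proof.
move=> ng; have [k gk] : exists k, g k != 0%N.
  apply/existsP; apply: contraNT ng; rewrite negb_exists => /forallP g0.
  by apply/eqP/mnmP => i; rewrite mnm0E; apply/eqP; have := g0 i; rewrite negbK.
by exists k, (g - U_(k))%MM; rewrite addmC submK // lep1mP.
Qed.

Lemma mpolyX_divisor p q g : p * q = 'X_[g] ->
  exists2 d, d \is a GRing.unit & exists g', p = d *: 'X_[g'].
Proof.
have [N] := ubnP (mdeg g); elim: N g p q => // N IH g p q size_g pqE.
have [g0|/mnm_neq0_var [k [g' gE]]] := eqVneq g 0%MM.
  have /andP [/eqP pC pU] : p \in @mpoly_unit n R.
    by apply: (@mpoly_intro_unit _ _ _ q); rewrite mulrC pqE g0 mpolyX0.
  by exists p@_0 => //; exists 0%MM; rewrite mpolyX0 alg_mpolyC.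
have size_g' : (mdeg g' < N)%N by move: size_g; rewrite gE mdegD mdeg1.
rewrite gE mpolyXD in pqE; have [[p' pE]|[q' qE]] := mpolyX_prime pqE.
  have p'qE : p' * q = 'X_[g'] by apply: (mulfI (mpolyX_neq0 U_(k))); rewrite mulrA -pE.
  have [d dU [g1 p'E]] := IH _ _ _ size_g' p'qE.
  by exists d => //; exists (U_(k) + g1)%MM; rewrite pE p'E mpolyXD scalerAr.
have pq'E : p * q' = 'X_[g'] by apply: (mulfI (mpolyX_neq0 U_(k))); rewrite mulrCA -qE.
exact: IH size_g' pq'E.
Qed.

End MultivariatePolynomials.

Definition pos_mnm m (a : 'I_m -> int) : 'X_{1..m} := [multinom absz (pos_part (a i)) | i < m].

Definition neg_mnm m (a : 'I_m -> int) : 'X_{1..m} := pos_mnm (fun i => - a i).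

Lemma pos_mnmE m (a : 'I_m -> int) i : (pos_mnm a i)%:Z = pos_part (a i).
Proof. by rewrite mnmE gez0_abs // pos_part_ge0. Qed.

Section AlgebraicIndependence.
Variables (K : idomainType) (E : fieldType) (h : {rmorphism K -> E}) (m : nat).
Implicit Types (y : 'I_m -> E) (a b : 'I_m -> int) (g : 'X_{1..m}).

Definition algindep y : Prop := injective (mmap h y).

Lemma mmap_var y i : mmap h y 'X_i = y i.
Proof. by rewrite mmapX mmap1U. Qed.

Lemma mmap1_lmonom y g : mmap1 y g = lmonom y (fun i => (g i)%:Z).
Proof. by apply: eq_bigr => i _; rewrite exprnP. Qed.

Lemma mmapZX y d g : mmap h y (d *: 'X_[g]) = h d * mmap1 y g.
Proof. by rewrite mmapZ mmapX. Qed.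

Lemma mmap1D y g g' : mmap1 y (g + g')%MM = mmap1 y g * mmap1 y g'.
Proof. by rewrite -!(mmapX y h) mpolyXD rmorphM. Qed.

Lemma lmonom_pos_neg y a : (forall i, y i != 0) ->
  lmonom y a * mmap1 y (neg_mnm a) = mmap1 y (pos_mnm a).
Proof.
move=> ny; rewrite !mmap1_lmonom -lmonomD //; apply: eq_lmonom => i.
by rewrite !pos_mnmE /pos_part; lia.
Qed.

Lemma subring_mmap (M : E -> Prop) y q :
  subring M -> (forall c, M (h c)) -> (forall i, M (y i)) -> M (mmap h y q).
Proof.
move=> M_subring Mh My; apply: subring_sum => // g _; apply: subringM => //.
by apply: subring_prod => // i _; exact: subringX.
Qed.

Section Independent.
Variable y : 'I_m -> E.
Hypothesis y_indep : algindep y.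

Lemma algindep_neq0 i : y i != 0.
Proof.
rewrite -(mmap_var y i) -(rmorph0 (mmap h y)) (inj_eq y_indep); exact: mpolyX_neq0.
Qed.

Lemma algindep_mmap1_neq0 g : mmap1 y g != 0.
Proof. by rewrite mmap1_lmonom lmonom_neq0 // => i; exact: algindep_neq0. Qed.

Lemma lmonom_inj d d' a b :
  d != 0 -> h d * lmonom y a = h d' * lmonom y b -> d = d' /\ a =1 b.
Proof.
move=> nd e; have ny := algindep_neq0.
pose c i := a i - b i.
have /y_indep polyE : mmap h y (d *: 'X_[pos_mnm c]) = mmap h y (d' *: 'X_[neg_mnm c]).
  rewrite !mmapZX -lmonom_pos_neg // mulrA; congr (_ * _).
  by rewrite [lmonom y c]lmonomD // lmonomN mulrA e mulfK // lmonom_neq0.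
have coefE g : d * (pos_mnm c == g)%:R = d' * (neg_mnm c == g)%:R.
  by have := congr1 (mcoeff g) polyE; rewrite !mcoeffZ !mcoeffX.
have pos_neg : neg_mnm c = pos_mnm c.
  apply/eqP; have := coefE (pos_mnm c); rewrite eqxx mulr1.
  by case: eqP => // _ /eqP; rewrite mulr0 (negbTE nd).
split; first by have := coefE (pos_mnm c); rewrite pos_neg eqxx !mulr1.
move=> i; have /mnmP /(_ i) := pos_neg; have := pos_mnmE c i.
have := pos_mnmE (fun l => - c l) i; rewrite -/(neg_mnm c) /c /pos_part; lia.
Qed.

Lemma exchange_not_monomial b d a : (exists i, b i != 0) -> exchange y b != h d * lmonom y a.
Proof.
move=> [i nbi]; apply/eqP => e.
have /y_indep polyE : mmap h y (('X_[pos_mnm b] + 'X_[neg_mnm b]) * 'X_[neg_mnm a]) =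
    mmap h y (d *: 'X_[pos_mnm a]).
  rewrite rmorphM mmapZX -(lmonom_pos_neg _ algindep_neq0) mulrA -e /= !mmapX mmapD !mmapX.
  congr (_ * _); rewrite exchangeE !mmap1_lmonom; congr (_ + _).
    by apply: eq_lmonom => l; rewrite pos_mnmE.
  by apply: eq_lmonom => l; rewrite pos_mnmE.
have pos_neg : pos_mnm b != neg_mnm b.
  apply/eqP => /mnmP /(_ i); have := pos_mnmE b i; have := pos_mnmE (fun l => - b l) i.
  by rewrite -/(neg_mnm b) /pos_part; lia.
have coefE g : (pos_mnm b == g)%:R + (neg_mnm b == g)%:R =
    d * (pos_mnm a == g + neg_mnm a)%MM%:R.
  rewrite -!mcoeffX -mcoeffD -(mcoeffMX _ (neg_mnm a)) [(neg_mnm a + g)%MM]addmC polyE.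
  by rewrite mcoeffZ !mcoeffX.
have := coefE (neg_mnm b); have := coefE (pos_mnm b).
rewrite !eqxx (negbTE pos_neg) [neg_mnm b == _]eq_sym (negbTE pos_neg) addr0 add0r.
case: eqP => [->|_ /eqP]; last by rewrite mulr0 oner_eq0.
rewrite (inj_eq (@addIm _ _)) (negbTE pos_neg) => _ /eqP.
by rewrite mulr0 oner_eq0.
Qed.

End Independent.
End AlgebraicIndependence.

Section LaurentPolynomials.
Variables (R : idomainType) (E : fieldType) (h : {rmorphism R -> E}) (m : nat).
Variables (inv : pred 'I_m) (y : 'I_m -> E).
Hypothesis y_indep : algindep h y.
Implicit Types (a b : 'I_m -> int) (g : 'X_{1..m}) (q : {mpoly R[m]}) (f u w : E).

Lemma laurent_ring_poly f : laurent_ring h inv y f ->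
  exists q g, (forall i, ~~ inv i -> g i = 0%N) /\ f * mmap1 y g = mmap h y q.
Proof.
have ny := algindep_neq0 y_indep; pose w := \prod_(i | inv i) y i.
pose P := image_in (mmap h y) (fun=> True).
have P_subring : subring P by apply: subring_image; split.
have Py i : P (y i) by exists 'X_i; rewrite //= mmap_var.
have Ph c : P (h c) by exists c%:MP; rewrite //= mmapC.
have Pw : P w by apply: subring_prod.
have Pwy i : inv i -> y i != 0 /\ P (w / y i).
  move=> ii; rewrite /w (bigD1 i) //= mulrAC mulfV // mul1r.
  by split=> //; apply: subring_prod.
case/(laurent_ring_clear_denom P_subring Pw Ph Py Pwy) => N [q _ fE].
exists q, [multinom if inv i then N else 0%N | i < m]; split=> [i /negbTE ii|].
  by rewrite mnmE ii.
rewrite -fE /mmap1 -prodrXl [in RHS]big_mkcond; congr (_ * _); apply: eq_bigr => i _.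
by rewrite mnmE; case: ifP.
Qed.

Definition scaled_monomial u a : Prop :=
  exists2 d, d \is a GRing.unit & u = h d * lmonom y a.

Lemma laurent_divisor_monomial u w a : laurent_ring h inv y u -> laurent_ring h inv y w ->
  u * w = lmonom y a -> exists2 b, scaled_monomial u b & forall i, ~~ inv i -> 0 <= b i.
Proof.
move=> /laurent_ring_poly [q1 [g1 [g1_inv e1]]] /laurent_ring_poly [q2 [g2 [_ e2]]] uwE.
have ny := algindep_neq0 y_indep.
have /mpolyX_divisor [d dU [g q1E]] :
    q1 * (q2 * 'X_[neg_mnm a]) = 'X_[(pos_mnm a + (g1 + g2))%MM].
  apply: y_indep; rewrite !rmorphM /= -e1 -e2 !mmapX !(mmap1D h) -lmonom_pos_neg // -uwE; ring.
exists (fun i => (g i)%:Z - (g1 i)%:Z) => [|i /g1_inv ->]; last by rewrite subr0.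
exists d => //; apply: (mulIf (algindep_mmap1_neq0 y_indep g1)).
by rewrite e1 q1E mmapZX lmonomD // lmonomN -!mmap1_lmonom mulrA mulfVK //
  (algindep_mmap1_neq0 y_indep).
Qed.

Lemma laurent_ring_fraction f q g : (forall i, ~~ inv i -> g i = 0%N) ->
  f * mmap1 y g = mmap h y q -> laurent_ring h inv y f.
Proof.
move=> g_inv fE; have ng := algindep_mmap1_neq0 y_indep g.
have L_subring := subring_laurent_ring h inv y.
rewrite -[f](mulfK ng) fE; apply: subringM => //.
  by apply: subring_mmap => // [c|i]; [exact: laurent_ring_const | exact: laurent_ring_var].
rewrite mmap1_lmonom; apply: unit_in_mem; apply/unit_inV/unit_in_lmonom => // i.
have [ii|/g_inv ->] := boolP (inv i); [right | by left].
by apply: laurent_ring_unit => //; exact: algindep_neq0 y_indep i.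
Qed.

(* If [f] is finite at a point with [v l = 0], its reduced denominator is not divisible by
   ['X_l]. *)
Lemma laurent_denominator_cancel (F : fieldType) (psi : {rmorphism R -> F}) v l f c g q :
  v l = 0 -> specialises (mmap h y) (mmap psi v) f c ->
  f * mmap1 y (U_(l) + g)%MM = mmap h y q -> exists q', f * mmap1 y g = mmap h y q'.
Proof.
move=> vl0 [p [r [nr fE _]]] qE; have nrh := specialised_neq0 y_indep nr.
have /y_indep /mpolyX_prime [[q' q'E]|[r' r'E]] :
    mmap h y (q * r) = mmap h y ('X_l * (p * 'X_[g])).
- rewrite !rmorphM /= -qE fE mmap_var (mmap1D h) mmap1U !mmapX mulrAC divfK //; ring.
- exists q'; apply: (mulfI (algindep_neq0 y_indep l)).
  by rewrite -[in RHS](mmap_var h) -rmorphM /= -q'E -qE (mmap1D h) mmap1U mulrCA.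
by move: nr; rewrite r'E rmorphM /= mmap_var vl0 mul0r eqxx.
Qed.

Lemma laurent_ring_no_pole (F : fieldType) (psi : {rmorphism R -> F}) f q g :
  f * mmap1 y g = mmap h y q ->
  (forall l, ~~ inv l -> exists v c, v l = 0 /\ specialises (mmap h y) (mmap psi v) f c) ->
  laurent_ring h inv y f.
Proof.
move=> fE finite_at; have [N] := ubnP (mdeg g); elim: N g q fE => // N IH g q fE size_g.
have [/forallP g_inv|] := boolP [forall i, ~~ inv i ==> (g i == 0%N)].
  by apply: laurent_ring_fraction fE => i ii; apply/eqP; apply: implyP (g_inv i) ii.
rewrite negb_forall => /existsP [l]; rewrite negb_imply -lep1mP => /andP [il /submK gE].
have [v [c [vl0 spec]]] := finite_at l il.
rewrite -gE addmC in fE size_g; have [q' fE'] := laurent_denominator_cancel vl0 spec fE.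
by apply: IH fE' _; move: size_g; rewrite mdegD mdeg1.
Qed.

End LaurentPolynomials.

Section ScalarExtension.
Variables (R K : idomainType) (E : fieldType) (m : nat).
Variables (k : {rmorphism R -> K}) (h : {rmorphism K -> E}) (h0 : {rmorphism R -> E}).
Hypothesis h0E : forall c, h0 c = h (k c).
Implicit Type y : 'I_m -> E.

Lemma mmap_map_mpoly y q : mmap h y (map_mpoly k q) = mmap h0 y q.
Proof.
elim/mpoly_ring_ind: q => [c|i|p q e e'|p q e e'].
- by rewrite map_mpolyC !mmapC /= h0E.
- by rewrite map_mpolyX !mmap_var.
- by rewrite !rmorphD /= e e'.
- by rewrite !rmorphM /= e e'.
Qed.

Lemma algindep_sub y : injective k -> algindep h y -> algindep h0 y.
Proof.
move=> k_inj y_indep p q; rewrite -!mmap_map_mpoly => /y_indep e; apply/mpolyP => g.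
by apply: k_inj; rewrite -!mcoeff_map_mpoly e.
Qed.

Lemma laurent_ring_extend inv y f : laurent_ring h0 inv y f -> laurent_ring h inv y f.
Proof.
have L_subring := subring_laurent_ring h inv y; apply: laurent_ring_min => // [c|i|i ii].
- by rewrite h0E; exact: laurent_ring_const.
- exact: laurent_ring_var.
- exact: laurent_ring_varV.
Qed.

Lemma laurent_ring_coef inv y d a : injective k -> algindep h y ->
  laurent_ring h0 inv y (h d * lmonom y a) -> exists c, d = k c.
Proof.
move=> k_inj y_indep; have ny := algindep_neq0 y_indep.
case/(laurent_ring_poly (algindep_sub k_inj y_indep)) => [q [g [_ e]]].
have /y_indep polyE : mmap h y (map_mpoly k (q * 'X_[neg_mnm a])) =
    mmap h y (d *: 'X_[pos_mnm a + g]).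
  rewrite mmap_map_mpoly rmorphM /= -e mmapX mmapZX (mmap1D h) -lmonom_pos_neg //; ring.
exists (q * 'X_[neg_mnm a])@_(pos_mnm a + g); rewrite -mcoeff_map_mpoly polyE.
by rewrite mcoeffZ mcoeffX eqxx mulr1.
Qed.

End ScalarExtension.

Section MutationOfIndependentVariables.
Variables (K : idomainType) (E : fieldType) (h : {rmorphism K -> E}) (m : nat).
Implicit Types (y v : 'I_m -> E) (B : 'I_m -> 'I_m -> int).

(* Denominators are cleared uniformly in the point [v], so that the polynomial [r] serves
   for a cluster as well as for its mutation, and mutating twice gives back [q]. *)
Lemma mmap_mu_var k B (q : {mpoly K[m]}) : exists (r : {mpoly K[m]}) d, forall v,
  v k != 0 -> mmap h (mu_var k v B) q * v k ^+ d = mmap h v r.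
Proof.
elim/mpoly_ring_ind: q => [c|i|p p' [r [d e]] [r' [d' e']]|p p' [r [d e]] [r' [d' e']]].
- by exists c%:MP, 0%N => v _; rewrite mulr1 !mmapC.
- have [->|nik] := eqVneq i k; last first.
    by exists 'X_i, 0%N => v _; rewrite mulr1 !mmap_var mu_var_other.
  exists ('X_[pos_mnm (B^~ k)] + 'X_[neg_mnm (B^~ k)]), 1%N => v nv.
  rewrite mmap_var mu_var_same expr1 mulrC mulVKf // mmapD !mmapX !mmap1_lmonom exchangeE.
  by congr (_ + _); apply: eq_lmonom => l; rewrite pos_mnmE.
- exists (r * 'X_k ^+ d' + r' * 'X_k ^+ d), (d + d')%N => v nv.
  rewrite !(rmorphD, rmorphM, rmorphXn) /= !mmap_var -e // -e' // exprD; ring.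
- exists (r * r'), (d + d')%N => v nv.
  by rewrite !rmorphM /= -e // -e' // exprD mulrACA.
Qed.

Lemma algindep_mu_var (mut : pred 'I_m) k y B : mut k -> skew_symmetrizable_on mut B ->
  mu_var k y B k != 0 -> algindep h y -> algindep h (mu_var k y B).
Proof.
move=> mk B_skew nz y_indep; apply: raddf_inj => q q0.
have [r [d rE]] := mmap_mu_var k B q.
have r0 : r = 0.
  by apply: (y_indep); rewrite rmorph0 -(rE y (algindep_neq0 y_indep k)) q0 mul0r.
apply: y_indep; rewrite rmorph0; have /eqP := rE _ nz.
rewrite (mu_var_involutive mk B_skew nz) r0 rmorph0 mulf_eq0 expf_eq0 (negbTE nz) andbF orbF.
by move/eqP.
Qed.

End MutationOfIndependentVariables.

(** * Positivity and cluster seeds *)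

Section Positivity.
Variables (F : realFieldType) (T : finType) (mut : pred T).
Implicit Types (v : T -> F) (b : T -> int).

(* At most one coordinate vanishes, and it is frozen: it cannot kill both monomials of an
   exchange relation. *)
Definition almost_positive v : Prop :=
  (forall i, mut i -> 0 < v i) /\ exists k, 0 <= v k /\ forall i, i != k -> 0 < v i.

Lemma almost_positive1 (i : T) : almost_positive (fun=> 1).
Proof. by split=> //; exists i; split. Qed.

Lemma almost_positive_indicator l : ~~ mut l -> almost_positive (fun i => (i != l)%:R).
Proof.
move=> ml; split=> [i mi|]; last by exists l; split=> // i ->.
by rewrite (contraNneq _ ml) // => <-.
Qed.

Lemma exchange_gt0 v b : almost_positive v -> 0 < exchange v b.
Proof.
case=> _ [k [vk_ge0 v_gt0]].
have v_ge0 i : 0 <= v i by have [->|/v_gt0 /ltW] := eqVneq i k.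
have monom_ge0 (P : pred T) : 0 <= \prod_(i | P i) v i ^+ `|b i|%N.
  by apply: prodr_ge0 => i _; exact: exprn_ge0.
have monom_gt0 (P : pred T) : ~~ P k -> 0 < \prod_(i | P i) v i ^+ `|b i|%N.
  move=> Pk; apply: prodr_gt0 => i Pi; apply/exprn_gt0/v_gt0.
  by apply: contraNneq Pk => <-.
have [bk|bk] := lerP 0 (b k).
  by apply: ltr_wpDl => //; apply: monom_gt0; rewrite -leNgt.
by apply: ltr_pwDl => //; apply: monom_gt0; rewrite -leNgt ltW.
Qed.

Lemma almost_positive_reachable v B S' :
  almost_positive v -> reachable mut (v, B) S' -> almost_positive S'.1.
Proof.
move=> v_pos; move: S'; apply: reachable_ind => // S' k mk _ [v_gt0 [l [vl_ge0 v_gt0']]].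
have new_gt0 : 0 < mu_var k S'.1 S'.2 k.
  rewrite mu_var_same mulr_gt0 ?invr_gt0 ?v_gt0 //.
  by apply: exchange_gt0; split=> //; exists l.
split=> [i mi|]; last exists l; last split=> [|i nil].
- by have [->//|nik] := eqVneq i k; rewrite /= mu_var_other // v_gt0.
- by have [->|nlk] := eqVneq l k; [exact: ltW | rewrite /= mu_var_other].
- by have [->//|nik] := eqVneq i k; rewrite /= mu_var_other // v_gt0'.
Qed.

End Positivity.

Section ClusterSeeds.
Variables (K : idomainType) (E : fieldType) (h : {rmorphism K -> E}) (m : nat).
Variable mut : pred 'I_m.
Hypothesis intr_inj : injective (intr : int -> K).
Implicit Types (S : seed E 'I_m) (v : 'I_m -> rat) (y : 'I_m -> E).

Definition cluster_seed S : Prop :=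
  [/\ algindep h S.1, skew_symmetrizable_on mut S.2
    & forall k, mut k -> exists i, S.2 i k != 0].

Lemma intr_morphE (z : int) : z%:~R = h z%:~R.
Proof. by rewrite rmorph_int. Qed.

Lemma algindep_int y : algindep h y -> algindep (intr : {rmorphism int -> E}) y.
Proof. exact: (algindep_sub (k := intr) intr_morphE). Qed.

Definition specialises_at y v : E -> rat -> Prop :=
  specialises (mmap (intr : {rmorphism int -> E}) y) (mmap (intr : {rmorphism int -> rat}) v).

Lemma specialises_at_var y v i : specialises_at y v (y i) (v i).
Proof.
rewrite -(mmap_var (intr : {rmorphism int -> E}) y) -(mmap_var (intr : {rmorphism int -> rat}) v).
exact: specialises_morph.
Qed.

Lemma specialises_at_int y v (z : int) : specialises_at y v z%:~R z%:~R.
Proof.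
rewrite -[z%:~R in X in specialises_at _ _ X](mmapC y (intr : {rmorphism int -> E})).
rewrite -[z%:~R in X in specialises_at _ _ _ X](mmapC v (intr : {rmorphism int -> rat})).
exact: specialises_morph.
Qed.

Lemma reachable_specialises S S' v i : algindep h S.1 -> almost_positive mut v ->
  reachable mut S S' -> exists2 c, mut i -> 0 < c & specialises_at S.1 v (S'.1 i) c.
Proof.
case: S => x B /= x_indep v_pos [ks mks <-] {S'}.
exists ((mu_path (v, B) ks).1 i).
  have rv : reachable mut (v, B) (mu_path (v, B) ks) by exists ks.
  by case: (almost_positive_reachable v_pos rv) => + _; exact.
apply: (specialises_mu_path (algindep_int x_indep) (mut := mut)) => // [l|S' rS' l ml].
  exact: specialises_at_var.
by case: (almost_positive_reachable v_pos rS') => /(_ l ml) /lt0r_neq0.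
Qed.

Lemma nonvanishing_cluster_seed S : cluster_seed S -> nonvanishing mut S.
Proof.
move=> [S_indep _ _] S' rS' i; have [mi|mi] := boolP (mut i); last first.
  by rewrite (reachable_frozen rS' mi) (algindep_neq0 S_indep).
have [c /(_ mi) c_gt0] := reachable_specialises i S_indep (almost_positive1 _ mut i) rS'.
by move/(specialises_neq0 (algindep_int S_indep)); apply; exact: lt0r_neq0.
Qed.

Lemma cluster_seed_mu S k : mut k -> cluster_seed S -> cluster_seed (mu S k).
Proof.
move=> mk S_seed; have nvS := nonvanishing_cluster_seed S_seed.
have [S_indep S_skew nz_col] := S_seed.
split=> [||l ml] /=; last 1 first.
- have [->|nlk] := eqVneq l k.
    by have [i nBik] := nz_col k mk; exists i; rewrite mu_mx_col oppr_eq0.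
  have [Bkl0|nBkl] := eqVneq (S.2 k l) 0; last by exists k; rewrite mu_mx_row oppr_eq0.
  have [i nBil] := nz_col l ml; exists i.
  have nik : i != k by apply: contraNneq nBil => ->; rewrite Bkl0.
  by rewrite (mu_mx_sign false) // Bkl0 !mulr0 !addr0.
- by apply: (algindep_mu_var mk S_skew) => //; apply: (nvS _ (reachable_mu S mk)).
- exact: skew_symmetrizable_mu.
Qed.

Lemma cluster_seed_reachable S S' : cluster_seed S -> reachable mut S S' -> cluster_seed S'.
Proof.
by move=> S_seed; move: S'; apply: reachable_ind => // S' k mk _; exact: cluster_seed_mu.
Qed.

Lemma cluster_seed_reachable_sym S S' :
  cluster_seed S -> reachable mut S S' -> reachable mut S' S.
Proof.
by move=> S_seed; have [_ S_skew _] := S_seed; apply/reachable_sym/nonvanishing_cluster_seed.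
Qed.

(* A cluster variable is finite at a positive point with one frozen coordinate equal to [0],
   so that only invertible variables occur in its denominator. *)
Lemma laurent_phenomenon_frozen (inv : pred 'I_m) S S' i :
  (forall l, mut l -> inv l) -> cluster_seed S -> reachable mut S S' ->
  int_laurent_ring inv S.1 (S'.1 i).
Proof.
move=> mut_inv S_seed rS'; have [S_indep S_skew _] := S_seed.
have S_indep' := algindep_int S_indep.
have /(laurent_ring_poly S_indep') [q [g [_ qE]]] :=
  laurent_phenomenon i S_skew (nonvanishing_cluster_seed S_seed) rS'.
apply: (laurent_ring_no_pole S_indep' (psi := intr) qE) => l il.
have ml : ~~ mut l by apply: contraNN il; exact: mut_inv.
have [c _ spec] := reachable_specialises i S_indep (almost_positive_indicator _ ml) rS'.
by exists (fun k => (k != l)%:R), c; rewrite eqxx.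
Qed.

End ClusterSeeds.

(** * Units, irreducible and associate elements *)

Section UnitsAndIrreducibles.
Variables (K : idomainType) (E : fieldType) (h : {rmorphism K -> E}) (m : nat).
Variables (mut inv : pred 'I_m).
Hypothesis intr_inj : injective (intr : int -> K).
Implicit Types (S : seed E 'I_m) (y : 'I_m -> E) (u w : E) (a b : 'I_m -> int).

(* If [a k < 0], then in the cluster mutated at [k] the exchange polynomial would divide a
   monomial. *)
Lemma mu_no_pole S k u a : cluster_seed h mut S -> mut k -> scaled_monomial h S.1 u a ->
  laurent_ring h inv (mu S k).1 u -> 0 <= a k.
Proof.
move=> S_seed mk [d dU uE] u_in; rewrite leNgt; apply/negP => ak_lt0.
have [S_indep S_skew nz_col] := S_seed; have [S'_indep _ _] := cluster_seed_mu intr_inj mk S_seed.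
set y := S.1 in S_indep uE; set y' := (mu S k).1 in S'_indep u_in.
pose M := exchange y' (S.2^~ k).
have ny := algindep_neq0 S_indep; have ny' := algindep_neq0 S'_indep.
have y'E i : i != k -> y i = y' i by move=> nik; rewrite /y' /= mu_var_other.
have yk : y k = M / y' k.
  apply: (mulIf (ny' k)); rewrite divfK // /M /y' /= (exchange_mu_var _ mk S_skew).
  by rewrite mu_var_same mulVKf.
have nM : M != 0 by have := ny k; rewrite yk mulf_eq0 negb_or => /andP [].
have [N aN] : exists N : nat, a k = - N.+1%:Z by exists (absz (a k)).-1; lia.
have ykX : M ^+ N.+1 * y k ^ a k = y' k ^+ N.+1.
  by rewrite aN -invr_expz -exprnP yk -exprVn -exprMn invf_div mulrCA mulfV // mulr1.
have h_dV : h d^-1 * h d = 1 by rewrite -rmorphM mulVr // rmorph1.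
have prodE : M * (M ^+ N * (h d^-1 * u)) =
    lmonom y' (fun i => erase k a i + delta k i * N.+1%:Z).
  rewrite uE mulrA -exprS [h d^-1 * _]mulrA h_dV mul1r lmonomD // lmonomX lmonom_delta.
  by rewrite (lmonom_erase k) mulrA ykX (eq_lmonom_erase a y'E) mulrC.
have L_subring := subring_laurent_ring h inv y'; have Ly' := laurent_ring_var h inv y'.
have LM : laurent_ring h inv y' M by apply: subring_exchange => // l; right.
have Lcofactor : laurent_ring h inv y' (M ^+ N * (h d^-1 * u)).
  apply: subringM => //; first exact: subringX.
  by apply: subringM => //; exact: laurent_ring_const.
have [e [d' _ ME] _] := laurent_divisor_monomial S'_indep LM Lcofactor prodE.
by have /eqP := exchange_not_monomial S'_indep d' e (nz_col k mk); apply.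
Qed.

Definition frozen_unit y u : Prop := exists2 a, scaled_monomial h y u a &
  forall i, mut i || ~~ inv i -> a i = 0.

Lemma frozen_unit_in y (M : E -> Prop) u : subring M -> (forall c, M (h c)) ->
  (forall i, ~~ mut i -> inv i -> unit_in M (y i)) -> frozen_unit y u -> unit_in M u.
Proof.
move=> M_subring Mh My [a [d dU ->] a0]; apply: unit_inM => //.
  split=> //; last by rewrite -rmorphV.
  by rewrite -unitfE rmorph_unit.
apply: unit_in_lmonom => // i.
have [/a0|] := boolP (mut i || ~~ inv i); first by left.
by rewrite negb_or negbK => /andP [mi ii]; right; apply: My.
Qed.

Variables (S : seed E 'I_m) (A : E -> Prop).
Hypothesis S_seed : cluster_seed h mut S.
Hypothesis A_laurent : forall f, A f -> laurent_ring h inv S.1 f.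
Hypothesis A_laurent_mu : forall k f, mut k -> A f -> laurent_ring h inv (mu S k).1 f.

Lemma divisor_monomial u w a : A u -> A w -> u * w = lmonom S.1 a ->
  exists2 b, scaled_monomial h S.1 u b & forall i, mut i || ~~ inv i -> 0 <= b i.
Proof.
move=> Au Aw uwE; have [S_indep _ _] := S_seed.
have [b ub b_ge0] := laurent_divisor_monomial S_indep (A_laurent Au) (A_laurent Aw) uwE.
exists b => // i /orP [mi|/b_ge0 //]; apply: (mu_no_pole S_seed mi ub); exact: A_laurent_mu.
Qed.

Lemma factors_monomial u w a : A u -> A w -> u * w = lmonom S.1 a ->
  exists b c, [/\ scaled_monomial h S.1 u b, scaled_monomial h S.1 w c,
    forall i, b i + c i = a i & forall i, mut i || ~~ inv i -> 0 <= b i /\ 0 <= c i].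
Proof.
move=> Au Aw uwE; have [S_indep _ _] := S_seed; have ny := algindep_neq0 S_indep.
have [b ub b_ge0] := divisor_monomial Au Aw uwE.
have wuE : w * u = lmonom S.1 a by rewrite mulrC.
have [c wc c_ge0] := divisor_monomial Aw Au wuE.
exists b, c; split=> // [|i hi]; last by split; auto.
have [[d dU uE] [d' d'U wE]] := (ub, wc).
have dd'U : d * d' \is a GRing.unit by rewrite unitrM dU.
have ndd' : d * d' != 0 by apply: contraTneq dd'U => ->; rewrite unitr0.
have [] // := lmonom_inj S_indep ndd' (d' := 1) (a := fun i => b i + c i) (b := a).
by rewrite -uwE uE wE lmonomD // rmorphM rmorph1 mul1r mulrACA.
Qed.

Lemma unit_frozen u w : A u -> A w -> u * w = 1 -> frozen_unit S.1 u.
Proof.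
rewrite -(lmonom0 S.1) => Au Aw /(factors_monomial Au Aw) [b [c [ub _ bc bc_ge0]]].
by exists b => // i /bc_ge0 []; have := bc i; lia.
Qed.

Lemma var_not_unit k w : mut k -> A (S.1 k) -> A w -> S.1 k * w <> 1.
Proof.
move=> mk Ak Aw /(unit_frozen Ak Aw) [a [d dU Ska] a0]; have [S_indep _ _] := S_seed.
have /(lmonom_inj S_indep (oner_neq0 K)) [_ /(_ k)] :
    h 1 * lmonom S.1 (delta k) = h d * lmonom S.1 a by rewrite rmorph1 mul1r lmonom_delta.
by rewrite /delta eqxx a0 ?mk.
Qed.

Lemma var_irreducible k u w : mut k -> A u -> A w -> S.1 k = u * w ->
  frozen_unit S.1 u \/ frozen_unit S.1 w.
Proof.
move=> mk Au Aw; rewrite -(lmonom_delta k) => /esym.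
case/(factors_monomial Au Aw) => [b [c [ub wc bc bc_ge0]]].
have [bk0|ck0] : b k = 0 \/ c k = 0.
  by have [] := bc_ge0 k; rewrite ?mk //; have := bc k; rewrite /delta eqxx; lia.
- left; exists b => // i hi; have [->//|nik] := eqVneq i k.
  by have [] := bc_ge0 i hi; have := bc i; rewrite /delta (negbTE nik); lia.
- right; exists c => // i hi; have [->//|nik] := eqVneq i k.
  by have [] := bc_ge0 i hi; have := bc i; rewrite /delta (negbTE nik); lia.
Qed.

End UnitsAndIrreducibles.

Section Associates.
Variables (K : idomainType) (E : fieldType) (h : {rmorphism K -> E}) (m : nat).
Variables (mut inv : pred 'I_m).
Hypothesis intr_inj : injective (intr : int -> K).
Hypothesis mut_inv : forall i, mut i -> inv i.
Implicit Types (S : seed E 'I_m) (y : 'I_m -> E) (a : 'I_m -> int).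

Lemma exponent_le0 y l a f f' (z : int) c c' : algindep h y -> c != 0 ->
  specialises_at y (fun i => (i != l)%:R) f c -> specialises_at y (fun i => (i != l)%:R) f' c' ->
  f = z%:~R * lmonom y a * f' -> a l <= 0.
Proof.
move=> y_indep nc fc f'c' fE; rewrite leNgt; apply/negP => al_gt0.
set v := (fun i => _) in fc f'c'.
have y_indep' := algindep_int intr_inj y_indep.
have monomial_at : specialises_at y v (lmonom y a) (lmonom v a).
  apply: specialises_lmonom => // [i|i]; first exact: specialises_at_var.
  by rewrite /v; have [->|_] := eqVneq i l; [right; apply: ltW | left; rewrite oner_neq0].
have := specialisesM (specialisesM (specialises_at_int y v z) monomial_at) f'c'.
rewrite -fE => /(specialises_uniq y_indep' fc) cE; move: nc; rewrite cE (lmonom_erase l).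
by rewrite /v eqxx exp0rz (gt_eqF al_gt0) !(mul0r, mulr0) eqxx.
Qed.

Lemma associate_scalar_int S S' i j d a : cluster_seed h mut S -> reachable mut S S' ->
  S'.1 i = h d * lmonom S.1 a * S.1 j -> exists z : int, d = z%:~R.
Proof.
move=> S_seed rS' e; have [S_indep _ _] := S_seed; have ny := algindep_neq0 S_indep.
apply: (laurent_ring_coef (intr_morphE h) (inv := inv) (a := fun i => a i + delta j i)
  intr_inj S_indep).
rewrite lmonomD // lmonom_delta mulrA -e.
exact: (laurent_phenomenon_frozen intr_inj i mut_inv S_seed rS').
Qed.

Lemma associate_var_exponent0 S S' i j z z' a : cluster_seed h mut S -> reachable mut S S' ->
  mut i -> mut j -> (forall l, mut l -> a l = 0) -> S'.1 i = z%:~R * lmonom S.1 a * S.1 j ->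
  S.1 j = z'%:~R * lmonom S.1 (fun l => - a l) * S'.1 i -> forall l, a l = 0.
Proof.
move=> S_seed rS' mi mj a_mut e e' l; have [S_indep _ _] := S_seed.
have [/a_mut //|ml] := boolP (mut l).
have v_pos := almost_positive_indicator rat ml.
have [c /(_ mi) c_gt0 spec_i] := reachable_specialises intr_inj i S_indep v_pos rS'.
have spec_j := specialises_at_var S.1 (fun i => (i != l)%:R) j.
have nvj : (j != l)%:R != 0 :> rat.
  by have -> : j != l by apply: contraNneq ml => <-.
apply/eqP; rewrite eq_le (exponent_le0 S_indep (lt0r_neq0 c_gt0) spec_i spec_j e) /=.
by rewrite -oppr_le0 (exponent_le0 S_indep nvj spec_j spec_i e').
Qed.

Lemma associate_var_eq S S' i j u : cluster_seed h mut S -> reachable mut S S' ->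
  mut i -> mut j -> frozen_unit h mut inv S.1 u -> S'.1 i = u * S.1 j -> S'.1 i = S.1 j.
Proof.
move=> S_seed rS' mi mj [a [d dU uE] a_frozen] e; rewrite uE in e.
have rS := cluster_seed_reachable_sym intr_inj S_seed rS'; have [S_indep _ _] := S_seed.
have a_mut l : mut l -> a l = 0 by move=> ml; apply: a_frozen; rewrite ml.
have nu : h d * lmonom S.1 a != 0.
  apply: mulf_neq0; first by rewrite -unitfE rmorph_unit.
  exact: lmonom_neq0 (algindep_neq0 S_indep).
have e' : S.1 j = h d^-1 * lmonom S.1 (fun i => - a i) * S'.1 i.
  by rewrite e lmonomN rmorphV // -invfM mulKf.
have [z dE] := associate_scalar_int S_seed rS' e.
have [z' d'E] : exists z' : int, d^-1 = z'%:~R.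
  have aN_mut l : mut l -> - a l = 0 by move/a_mut->; rewrite oppr0.
  move: e'; rewrite -(lmonom_frozen rS' aN_mut).
  exact: associate_scalar_int (cluster_seed_reachable intr_inj S_seed rS') rS.
have zz' : z' * z = 1 by apply: intr_inj; rewrite rmorphM /= -dE -d'E mulVr.
rewrite dE -intr_morphE in e; rewrite d'E -intr_morphE in e'.
have a0 := associate_var_exponent0 S_seed rS' mi mj a_mut e e'.
rewrite (eq_lmonom _ a0) lmonom0 mulr1 in e.
have v_pos := almost_positive1 rat mut i.
have [c /(_ mi) c_gt0 spec_i] := reachable_specialises intr_inj i S_indep v_pos rS'.
have spec_j := specialisesM (specialises_at_int S.1 (fun=> 1) z) (specialises_at_var _ _ j).
rewrite -e in spec_j.
have cE := specialises_uniq (algindep_int intr_inj S_indep) spec_i spec_j.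
move: c_gt0; rewrite {}cE mulr1 ltr0z => z_gt0.
by have /orP [/eqP z1|/eqP z1] := intUnitRing.unitzPl zz'; rewrite e z1 ?mul1r // in z_gt0 *.
Qed.

End Associates.

(** * Factorial subalgebras *)

Section FactorialSubrings.
Variables (K : idomainType) (m : nat) (V : F K m -> Prop).
Hypothesis V_subring : subring V.
Implicit Types a b c d f g p q w : F K m.

Lemma unitInP a : unitIn V a <-> unit_in V a.
Proof.
split=> [[Va [b [Vb ab1]]]|[na Va VaV]]; last first.
  by split=> //; exists a^-1; rewrite mulfV.
have na : a != 0 by apply: contra_eq_neq ab1 => ->; rewrite mul0r eq_sym oner_neq0.
by split=> //; rewrite -[a^-1]mulr1 -ab1 mulKf.
Qed.

Lemma dvdIn_mem_prod a q (s : seq (F K m)) :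
  (forall r, r \in s -> V r) -> q \in s -> dvdIn V a q -> dvdIn V a (\prod_(r <- s) r).
Proof.
move=> Vs qs [c [Vc qE]]; exists (c * \prod_(r <- rem q s) r); split.
  apply: subringM => //; rewrite big_seq; apply: subring_prod => // r /mem_rem; exact: Vs.
by rewrite (perm_big _ (perm_to_rem qs)) big_cons /= qE mulrA.
Qed.

Lemma irredIn_unit_mul a d : irredIn V a -> unit_in V d -> irredIn V (a * d).
Proof.
move=> [Va [na [nua irr]]] ud; have [nd Vd VdV] := ud.
split; first exact: subringM.
split; first by move/eqP; rewrite mulf_eq0 (negbTE nd) orbF => /eqP.
split=> [/unitInP uad|b c Vb Vc adE].
  by apply: nua; apply/unitInP; rewrite -[a](mulfK nd); exact: unit_inM (unit_inV ud).
have aE : a = b * (c / d) by rewrite mulrA -adE mulfK.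
case: (irr b (c / d) Vb (subringM V_subring Vc VdV) aE) => [|/unitInP ucd]; [by left | right].
by apply/unitInP; rewrite -[c](divfK nd); exact: unit_inM ucd ud.
Qed.

Lemma factorial_decomposition a : is_factorial V -> V a -> a != 0 ->
  exists e s, [/\ unit_in V e, forall q, q \in s -> irredIn V q & a = e * \prod_(q <- s) q].
Proof.
move=> [_ [decomp _]] Va /eqP na; have [ua|nua] := classic (unitIn V a).
  by exists a, [::]; split=> //; [apply/unitInP | rewrite big_nil mulr1].
have [s [irr_s aE]] := decomp a Va na nua.
by exists 1, s; split=> //; [exact: unit_in1 | rewrite mul1r].
Qed.

Lemma factorial_irredIn_dvd_factor a (s t : seq (F K m)) : is_factorial V -> irredIn V a ->
  (forall q, q \in s -> irredIn V q) -> (forall q, q \in t -> irredIn V q) ->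
  a * \prod_(q <- s) q = \prod_(q <- t) q -> exists2 q, q \in t & dvdIn V a q.
Proof.
move=> [_ [_ uniq_fact]] irr_a irr_s irr_t asE.
have prodE : \prod_(q <- a :: s) q = \prod_(q <- t) q by rewrite big_cons.
have irr_as q : q \in a :: s -> irredIn V q by rewrite inE => /predU1P [->|/irr_s].
have [[|q t'] [perm_t [// _ /(_ 0%N isT) [u [/unitInP [nu _ VuV] /= aE]]]]] :=
  uniq_fact _ _ irr_as irr_t prodE.
exists q; first by rewrite (perm_mem perm_t) inE eqxx.
by exists u^-1; rewrite aE mulrAC mulfV // mul1r.
Qed.

(* In [b c = a d], compare the factorisations of both sides: up to a unit, [a] is one of the
   irreducible factors of [b] or of [c]. *)
Lemma factorial_irredIn_primeIn a : is_factorial V -> irredIn V a -> primeIn V a.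
Proof.
move=> V_fact irr_a; have [Va [na [nua _]]] := irr_a; have V0 := subring0 V_subring.
do 3!split=> //; move=> b c Vb Vc [d [Vd bcE]].
have [b0|nb] := eqVneq b 0; first by left; exists 0; rewrite b0 mulr0.
have [c0|nc] := eqVneq c 0; first by right; exists 0; rewrite c0 mulr0.
have nd : d != 0 by apply: contraTneq (mulf_neq0 nb nc) => d0; rewrite bcE d0 mulr0 eqxx.
have [eb [sb [ub irr_b bE]]] := factorial_decomposition V_fact Vb nb.
have [ec [sc [uc irr_c cE]]] := factorial_decomposition V_fact Vc nc.
have [ed [sd [ud irr_d dE]]] := factorial_decomposition V_fact Vd nd.
pose e := ed / (eb * ec).
have ue : unit_in V e.
  by apply: (unit_inM V_subring ud); apply: unit_inV; exact: unit_inM ub uc.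
have [[neb Veb _] [nec Vec _]] := (ub, uc).
have prodE : a * e * \prod_(q <- sd) q = \prod_(q <- sb ++ sc) q.
  have ne := mulf_neq0 neb nec; apply: (mulfI ne).
  rewrite big_cat /= [RHS]mulrACA -bE -cE bcE dE /e.
  by rewrite mulrA [LHS]mulrA [_ * (a * ed / _)]mulrC (divfK ne) mulrA.
have irr_bc q : q \in sb ++ sc -> irredIn V q by rewrite mem_cat => /orP [/irr_b|/irr_c].
have [q q_bc [k [Vk qE]]] :=
  factorial_irredIn_dvd_factor V_fact (irredIn_unit_mul irr_a ue) irr_d irr_bc prodE.
have a_dvd_q : dvdIn V a q.
  by exists (e * k); rewrite mulrA; split=> //; apply: subringM => //; case: ue.
have dvd_factored x ex s : V ex -> (forall r, r \in s -> irredIn V r) ->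
    x = ex * \prod_(r <- s) r -> q \in s -> dvdIn V a x.
  move=> Vex irr_s -> qs.
  have [|l [Vl ->]] := dvdIn_mem_prod _ qs a_dvd_q; first by move=> r /irr_s [].
  by exists (ex * l); rewrite mulrCA; split=> //; exact: subringM.
move: q_bc; rewrite mem_cat => /orP [qb|qc].
  by left; exact: (dvd_factored _ _ _ Veb irr_b bE qb).
by right; exact: (dvd_factored _ _ _ Vec irr_c cE qc).
Qed.

Lemma primeIn_not_dvd_prod p (J : finType) (Q : pred J) (z : J -> F K m) N : primeIn V p ->
  (forall j, Q j -> V (z j) /\ ~ dvdIn V p (z j)) -> ~ dvdIn V p ((\prod_(j | Q j) z j) ^+ N).
Proof.
move=> [Vp [_ [nup prime]]] ndvd.
pose avoids w := V w /\ ~ dvdIn V p w.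
have avoids1 : avoids 1.
  split=> [|[c [Vc pc1]]]; first exact: subring1.
  by apply: nup; split=> //; exists c.
have avoidsM a b : avoids a -> avoids b -> avoids (a * b).
  by move=> [Va na] [Vb nb]; split=> [|/(prime _ _ Va Vb) []]; first exact: subringM.
have [] // : avoids ((\prod_(j | Q j) z j) ^+ N).
elim: N => [|N IH]; first by rewrite expr0.
by rewrite exprS; apply: (avoidsM) IH; exact: (big_ind avoids).
Qed.

Lemma primeIn_cancel p w f :
  primeIn V p -> V w -> ~ dvdIn V p w -> V (f * p) -> V (f * w) -> V f.
Proof.
move=> [Vp [/eqP np [_ prime]]] Vw ndvd Vfp Vfw.
have [|[c [Vc fpE]]|//] := prime (f * p) w Vfp Vw.
  by exists (f * w); split=> //; rewrite mulrCA mulrA.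
by rewrite -[f](mulfK np) fpE mulrC mulKf.
Qed.

(* The primes [y i] can be cancelled one by one from the denominator of [f]. *)
Lemma localisation_primes (I J : finType) (P : pred I) (Q : pred J)
    (y : I -> F K m) (z : J -> F K m) f :
  (forall i, P i -> primeIn V (y i)) -> (forall j, Q j -> V (z j)) ->
  (forall i j, P i -> Q j -> ~ dvdIn V (y i) (z j)) ->
  localisation V (\prod_(i | P i) y i) f -> localisation V (\prod_(j | Q j) z j) f -> V f.
Proof.
move=> prime_y Vz ndvd [M Vfy] [N Vfz]; set w := (\prod_(j | Q j) z j) ^+ N in Vfz.
have Vw : V w by apply: subringX => //; exact: subring_prod.
pose cancels e := V e /\ forall g, V (g * w) -> V (g * e) -> V g.
have cancels1 : cancels 1 by split=> [|g _]; [exact: subring1 | rewrite mulr1].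
have cancelsM a b : cancels a -> cancels b -> cancels (a * b).
  move=> [Va ca] [Vb cb]; split=> [|g Vgw]; first exact: subringM.
  rewrite mulrA => Vgab; apply: (ca) => //; apply: cb => //.
  by rewrite mulrAC; exact: subringM.
have cancels_y i : P i -> cancels (y i).
  move=> Pi; have yi_prime := prime_y i Pi; split=> [|g Vgw Vgy]; first by case: yi_prime.
  apply: (primeIn_cancel yi_prime Vw) Vgy Vgw.
  by apply: (primeIn_not_dvd_prod yi_prime) => j Qj; split; [exact: Vz | exact: ndvd].
have [_ cancel_prod] : cancels ((\prod_(i | P i) y i) ^+ M).
  elim: (M) => [|k IH]; first by rewrite expr0.
  by rewrite exprS; apply: (cancelsM) IH; exact: (big_ind cancels).
exact: cancel_prod.
Qed.

End FactorialSubrings.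

(** * Cluster algebras of exchange matrices *)

Definition below (m k : nat) : pred 'I_m := fun i => (i < k)%N.

Section SeedsFromMatrices.
Variables (K : idomainType) (m n : nat).
Hypothesis le_nm : (n <= m)%N.
Implicit Types (x y : 'I_m -> F K m) (B C : 'M[int]_(m, n)).

Definition Kemb_morph : {rmorphism K -> F K m} := @tofrac _ \o @mpolyC m K.

(* The missing columns [n <= j < m] are filled with zeros. *)
Definition square_mx B : 'I_m -> 'I_m -> int := fun i j => Bnat B i j.

Lemma BnatE B (i : 'I_m) (j : 'I_n) : Bnat B i j = B i j.
Proof. by rewrite /Bnat !valK. Qed.

Lemma Bnat_out B (i j : nat) : (n <= j)%N -> Bnat B i j = 0.
Proof. by move=> le_nj; rewrite /Bnat [insub j]insubN -?leqNgt //; case: insub. Qed.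

Lemma mu_mutate x B (k : 'I_n) : mu (x, square_mx B) (widen_ord le_nm k) =
  ((mutate k (x, B)).1, square_mx (mutate k (x, B)).2).
Proof.
congr (_, _); apply: functional_extensionality => i.
  rewrite /mu_var /= /mutx -[i == widen_ord le_nm k]/(val i == val k); case: eqP => // _.
  by congr (_ * (_ + _)); apply: eq_big => l; rewrite /square_mx /= BnatE.
apply: functional_extensionality => j.
rewrite /square_mx /mu_mx /=; have [lt_jn|le_nj] := ltnP j n; last first.
  by rewrite !(Bnat_out _ _ le_nj) !(normr0, mulr0, addr0, div0z, oppr0) if_same.
have BE C : Bnat C i j = C i (Ordinal lt_jn) := BnatE C i (Ordinal lt_jn).
by rewrite !BE mxE.
Qed.

Lemma reachable_cluster x B y : is_cluster x B y ->
  exists2 S, reachable (below n) (x, square_mx B) S & y = S.1.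
Proof.
case=> C [ks ksE]; exists (y, square_mx C) => //.
elim: ks x B ksE => [|k ks IH] x B /= => [[-> ->]|/IH]; first exact: reachable_refl.
rewrite -mu_mutate; apply: reachable_trans; apply: reachable_mu.
exact: (ltn_ord k).
Qed.

Lemma skew_symmetrizable_square_mx B :
  skew_symmetrizable (principal B) -> skew_symmetrizable_on (below n) (square_mx B).
Proof.
case=> d [dp dB]; exists (fun i => if insub (val i) is Some i' then d i' else 1).
split=> [i mi|i j mi mj]; first by rewrite insubT.
by rewrite !insubT; have := dB (Ordinal mi) (Ordinal mj); rewrite !mxE.
Qed.

Lemma connected_nonzero_column B k : (1 < m)%N -> connectedB B ->
  skew_symmetrizable_on (below n) (square_mx B) -> below n k -> exists i, square_mx B i k != 0.
Proof.
move=> m_gt1 conn B_skew mk.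
have [j njk] : exists j : 'I_m, j != k.
  have : (0 < #|[set~ k]|)%N by rewrite cardsC1 card_ord -subn1 subn_gt0.
  by case/card_gt0P => j; rewrite !inE; exists j.
have /connectP [[|l ls] /=] := conn k j; first by move=> _ jk; rewrite jk eqxx in njk.
case/andP=> /orP [nBkl|nBlk] _ _; last by exists l.
have ml : below n l by rewrite /below ltnNge; apply: contraNN nBkl => /Bnat_out ->.
exists l; apply: contraNneq nBkl => Blk0.
have [d [dp dB]] := B_skew; have := dB k l mk ml; rewrite Blk0 mulr0 oppr0 => /eqP.
by rewrite mulf_eq0 gt_eqF ?dp.
Qed.

Lemma is_seed_cluster_seed x B : (1 < m)%N -> is_seed x B ->
  cluster_seed Kemb_morph (below n) (x, square_mx B).
Proof.
move=> m_gt1 [conn [/skew_symmetrizable_square_mx B_skew x_indep]]; split=> //.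
- apply: raddf_inj; exact: x_indep.
- by move=> k; exact: connected_nonzero_column.
Qed.

End SeedsFromMatrices.

Lemma subring_Ksubalg (K : idomainType) (m : nat) (V : F K m -> Prop) : Ksubalg V -> subring V.
Proof.
case=> [VK [VD [VN VM]]]; split=> //.
by have := VK 1; rewrite /Kemb mpolyC1 tofrac1.
Qed.

Lemma gen_min (K : idomainType) (m : nat) (G V : F K m -> Prop) f : subring V ->
  (forall c, V (Kemb m c)) -> (forall g, G g -> V g) -> gen G f -> V f.
Proof.
move=> V_subring VK GV; elim=> // [a b _ Va _ Vb|a _ Va|a b _ Va _ Vb].
- exact: subringD.
- exact: subringN.
- exact: subringM.
Qed.

Lemma laurentP (K : idomainType) (m p : nat) (y : 'I_m -> F K m) f :
  laurent p y f <-> laurent_ring (Kemb_morph K m) (below p) y f.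
Proof.
split.
  apply: gen_min; first exact: subring_laurent_ring.
    exact: (laurent_ring_const (Kemb_morph K m)).
  move=> _ [i [[ip [->|->]]|[_ ->]]]; try exact: laurent_ring_var.
  exact: laurent_ring_varV.
apply: laurent_ring_min; [|exact: gen_K|move=> i|by move=> i ip; apply: gen_base; exists i; auto].
  apply: subring_Ksubalg; split; first exact: gen_K.
  by split; [exact: gen_add | split; [exact: gen_opp | exact: gen_mul]].
by apply: gen_base; exists i; have [ip|ip] := ltnP i p; [left | right]; auto.
Qed.

Lemma char0_intr_inj (K : idomainType) :
  ((forall c : K, c != 0 -> c \is a GRing.unit) /\ [pchar K] =i pred0)
    \/ (exists f : {rmorphism int -> K}, bijective f) ->
  injective (intr : int -> K).
Proof.
case=> [[_ /pcharf0P nat_eq0]|[f [g fK _]]]; last first.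
  by move=> a b e; apply: (can_inj fK); rewrite -[a]intz -[b]intz !rmorph_int.
apply: raddf_inj => -[] k /eqP; rewrite ?NegzE ?mulrNz ?oppr_eq0.
  by rewrite [_ == 0]nat_eq0 => /eqP ->.
by rewrite [_ == 0]nat_eq0.
Qed.

Section ClusterAlgebra.
Variables (K : idomainType) (m n p : nat).
Hypothesis intr_inj : injective (intr : int -> K).
Hypotheses (m_gt1 : (1 < m)%N) (le_pm : (p <= m)%N) (le_np : (n <= p)%N).
Variables (x : 'I_m -> F K m) (B : 'M[int]_(m, n)).
Hypothesis x_seed : is_seed x B.

Let mut : pred 'I_m := below n.
Let inv : pred 'I_m := below p.
Let h : {rmorphism K -> F K m} := Kemb_morph K m.
Let S0 : seed (F K m) 'I_m := (x, square_mx B).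
Let A := clalg p x B.
Implicit Types S : seed (F K m) 'I_m.

Let mut_inv i : mut i -> inv i. Proof. by move=> mi; exact: leq_trans mi le_np. Qed.
Let S0_seed : cluster_seed h mut S0. Proof. exact: is_seed_cluster_seed. Qed.

Lemma clalg_laurent S f : reachable mut S0 S -> A f -> laurent_ring h inv S.1 f.
Proof.
move=> rS; have L_subring := subring_laurent_ring h inv S.1.
apply: gen_min => // {f} [c|f]; first exact: (laurent_ring_const h).
have x_frozen (i : 'I_m) : (n <= i)%N -> x i = S.1 i.
  by move=> le_ni; rewrite (reachable_frozen rS) // /mut /below -leqNgt.
case=> [[i [/andP [le_ni ip] [->|->]]]|[[i [le_pi ->]]|]].
- by rewrite x_frozen //; exact: laurent_ring_var.
- by rewrite x_frozen //; exact: laurent_ring_varV.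
- by rewrite (x_frozen i (leq_trans le_np le_pi)); exact: laurent_ring_var.
case=> _ [/(reachable_cluster (leq_trans le_np le_pm)) [S' rS' ->] [i [_ ->]]].
apply: (laurent_ring_extend (intr_morphE h)).
apply: (laurent_phenomenon_frozen intr_inj i mut_inv).
  exact: (cluster_seed_reachable intr_inj S0_seed rS).
exact: reachable_trans (cluster_seed_reachable_sym intr_inj S0_seed rS) rS'.
Qed.

Lemma clalg_Uyz S S' f :
  reachable mut S0 S -> reachable mut S0 S' -> A f -> Uyz p S.1 S'.1 f.
Proof. by move=> rS rS' Af; split; apply/laurentP; exact: clalg_laurent. Qed.

Variable V : F K m -> Prop.
Hypotheses (V_alg : Ksubalg V) (VA : forall f, V f -> A f).
Hypothesis V_inv : forall i : 'I_m, (n <= i < p)%N -> V (x i) /\ V (x i)^-1.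

Let V_subring : subring V := subring_Ksubalg V_alg.
Let VK c : V (h c). Proof. exact: (proj1 V_alg). Qed.

Let V_laurent S f : reachable mut S0 S -> V f -> laurent_ring h inv S.1 f.
Proof. by move=> rS /VA; exact: clalg_laurent. Qed.

Let V_laurent_mu S k f : reachable mut S0 S -> mut k -> V f -> laurent_ring h inv (mu S k).1 f.
Proof.
by move=> rS mk; apply: V_laurent; apply: reachable_trans rS _; exact: reachable_mu.
Qed.

Lemma frozen_unit_in_subalgebra S u :
  reachable mut S0 S -> frozen_unit h mut inv S.1 u -> unitIn V u.
Proof.
move=> rS u_frozen; apply/unitInP.
apply: frozen_unit_in u_frozen => // i mi ii; rewrite (reachable_frozen rS mi).
have [|Vxi VxiV] := V_inv (i := i); first by rewrite leqNgt mi.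
by split=> //; have [x_indep _ _] := S0_seed; exact: (algindep_neq0 x_indep i).
Qed.

Lemma cluster_var_irredIn S k :
  reachable mut S0 S -> mut k -> V (S.1 k) -> irredIn V (S.1 k).
Proof.
move=> rS mk Vk; have S_seed := cluster_seed_reachable intr_inj S0_seed rS.
have [S_indep _ _] := S_seed.
split=> //; split; first by apply/eqP; exact: algindep_neq0 S_indep k.
have VS f : V f -> laurent_ring h inv S.1 f by exact: V_laurent.
have VS' l f : mut l -> V f -> laurent_ring h inv (mu S l).1 f by exact: V_laurent_mu.
split=> [[_ [v [Vv e]]]|b c Vb Vc e].
  exact: (var_not_unit intr_inj S_seed VS VS' mk Vk Vv e).
have [] := var_irreducible intr_inj S_seed VS VS' mk Vb Vc e;
  by move/(frozen_unit_in_subalgebra rS); auto.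
Qed.

Lemma dvdIn_cluster_var_eq S S' i j : reachable mut S0 S -> reachable mut S0 S' ->
  mut i -> mut j -> V (S.1 i) -> V (S'.1 j) -> dvdIn V (S.1 i) (S'.1 j) -> S.1 i = S'.1 j.
Proof.
move=> rS rS' mi mj Vi Vj [c [Vc e]].
have S_seed := cluster_seed_reachable intr_inj S0_seed rS.
have [_ [_ [nu _]]] := cluster_var_irredIn rS mi Vi.
have [_ [_ [_ irr]]] := cluster_var_irredIn rS' mj Vj.
have [//|[_ [c' [Vc' cc']]]] := irr _ _ Vi Vc e.
have c_frozen : frozen_unit h mut inv S.1 c.
  apply: (unit_frozen intr_inj S_seed _ _ Vc Vc' cc') => [f|k f mk]; first exact: V_laurent.
  exact: V_laurent_mu.
apply/esym; apply: (associate_var_eq intr_inj mut_inv S_seed _ mj mi c_frozen).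
  exact: reachable_trans (cluster_seed_reachable_sym intr_inj S0_seed rS) rS'.
by rewrite mulrC.
Qed.

Lemma laurent_localisation S f : (forall i : 'I_m, (p <= i)%N -> V (x i)) ->
  reachable mut S0 S -> (forall i, mut i -> V (S.1 i)) ->
  laurent p S.1 f -> localisation V (\prod_(i | mut i) S.1 i) f.
Proof.
move=> V_frozen rS V_mut /laurentP.
have [S_indep _ _] := cluster_seed_reachable intr_inj S0_seed rS.
have Vw : V (\prod_(i | mut i) S.1 i) by apply: subring_prod.
have V_mid i : ~~ mut i -> inv i -> V (S.1 i) /\ V (S.1 i)^-1.
  by move=> mi ii; rewrite (reachable_frozen rS mi); apply: V_inv; rewrite leqNgt mi.
apply: laurent_ring_clear_denom => // i.
  have [/V_mut //|mi] := boolP (mut i).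
  have [ii|ii] := boolP (inv i); first by have [] := V_mid i mi ii.
  by rewrite (reachable_frozen rS mi); apply: V_frozen; rewrite leqNgt.
move=> ii; split; first exact: algindep_neq0 S_indep i.
have [mi|mi] := boolP (mut i); last by apply: subringM => //; have [] := V_mid i mi ii.
rewrite (bigD1 i) //= mulrAC mulfV ?mul1r; last exact: algindep_neq0 S_indep i.
by apply: subring_prod => // l /andP [ml _]; exact: V_mut.
Qed.

Hypothesis V_factorial : is_factorial V.

Lemma cluster_var_primeIn S k :
  reachable mut S0 S -> mut k -> V (S.1 k) -> primeIn V (S.1 k).
Proof.
by move=> rS mk Vk; apply: factorial_irredIn_primeIn => //; exact: cluster_var_irredIn.
Qed.

Lemma Uyz_factorial_subalgebra S S' f : (forall i : 'I_m, (p <= i)%N -> V (x i)) ->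
  reachable mut S0 S -> reachable mut S0 S' -> disjoint_clusters n S.1 S'.1 ->
  (forall i, mut i -> V (S.1 i)) -> (forall i, mut i -> V (S'.1 i)) ->
  Uyz p S.1 S'.1 f -> V f.
Proof.
move=> V_frozen rS rS' disj VS VS' [/laurent_localisation fS /laurent_localisation fS'].
apply: (localisation_primes V_subring _ VS' _ (fS _ _ _) (fS' _ _ _)) => // [i mi|i j mi mj dvd].
  exact: cluster_var_primeIn (VS i mi).
by apply: (disj i j mi mj); apply: dvdIn_cluster_var_eq => //; [exact: VS | exact: VS'].
Qed.

End ClusterAlgebra.

Theorem theorem1p4 (K : idomainType) (m n p : nat)
  (hK : ((forall c : K, c != 0 -> c \is a GRing.unit) /\ [pchar K] =i pred0)
        \/ (exists f : {rmorphism int -> K}, bijective f))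
  (hm : (1 < m)%N) (hpm : (p <= m)%N) (hnp : (n <= p)%N) (hn : (1 <= n)%N)
  (x : 'I_m -> F K m) (B : 'M[int]_(m, n)) (hseed : is_seed x B)
  (y z : 'I_m -> F K m) (hy : is_cluster x B y) (hz : is_cluster x B z)
  (hyz : disjoint_clusters n y z)
  (U : F K m -> Prop) (hU : Ksubalg U) (hUA : forall f, U f -> clalg p x B f)
  (hUfact : is_factorial U)
  (hUy : forall i : 'I_m, (i < n)%N -> U (y i))
  (hUz : forall i : 'I_m, (i < n)%N -> U (z i))
  (hUx1 : forall i : 'I_m, (n <= i < p)%N -> U (x i) /\ U (x i)^-1)
  (hUx2 : forall i : 'I_m, (p <= i)%N -> U (x i)) :
  (forall f, U f <-> clalg p x B f) /\
  (forall f, clalg p x B f <-> Uyz p y z f) /\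
  is_factorial (clalg p x B) /\
  (forall f, is_cluster_var x B f -> primeIn (clalg p x B) f).
Proof.
have K_char0 := char0_intr_inj hK; have le_nm := leq_trans hnp hpm.
have [Y rY yE] := reachable_cluster le_nm hy; have [Z rZ zE] := reachable_cluster le_nm hz.
subst y z.
have A_Uyz f : clalg p x B f -> Uyz p Y.1 Z.1 f by exact: clalg_Uyz.
have Uyz_U f : Uyz p Y.1 Z.1 f -> U f.
  exact: (Uyz_factorial_subalgebra K_char0 hm hpm hnp hseed hU hUA hUx1 hUfact).
have UA f : U f <-> clalg p x B f by split; [exact: hUA | move/A_Uyz/Uyz_U].
have <- : U = clalg p x B.
  by apply: functional_extensionality => f; apply: propositional_extensionality.
split=> //; split=> [f|]; first by split; [move/hUA/A_Uyz | exact: Uyz_U].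
split=> // f f_var; have /UA : clalg p x B f by apply: gen_base; right; right.
case: f_var => _ [/(reachable_cluster le_nm) [S rS ->] [i [lt_in ->]]].
exact: (cluster_var_primeIn K_char0 hm hpm hnp hseed hU hUA hUx1).
Qed.
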